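(* Let $X\subseteq\mathbb{P}^r$ be a quasi-projective variety of dimension $n\ge 1$. If $\tau(X)=\operatorname{Sec}(X)$, then the third fundamental form $\mathbf{III}_x$ is zero at a generic point $x\in X$.
   Context: Work over $\mathbb{C}$; a variety is separated, reduced, irreducible, of finite type over $\mathbb{C}$. $\tau(X)$ is the tangent variety: the Zariski closure in $\mathbb{P}^r$ of the union of the projective tangent spaces of $X$ at its nonsingular points. $\operatorname{Sec}(X)$ is the secant variety: the Zariski closure of the union of the lines through two distinct points of $X$. Let $L=\mathcal{O}_X(1)$, $V=H^0(\mathbb{P}^r,\mathcal{O}_{\mathbb{P}^r}(1))$. For $k\ge 0$ let $P^k(L)=pr_{1,*}\big((\mathcal{O}_{X\times X}/I_\Delta^{k+1})\otimes pr_2^*L\big)$ be the sheaf of $k$-th order principal parts, with universal differential operator $d^k_L:L\to P^k(L)$ induced by $pr_2$. The Taylor series map is $\alpha_k:V\otimes\mathcal{O}_X\to P^k(L)$, $T\otimes a\mapsto a\,d^k_L(T|_X)$, and $R_k=(\ker\alpha_k)\otimes L^*$. Over the nonsingular locus of $X$, the kernel of the truncation $P^k(L)\to P^{k-1}(L)$ is $S^k\Omega^1_X\otimes L$, and $\alpha_k$ restricted to $R_{k-1}\otimes L$ lands in it; twisting by $L^*$ gives the $k$-th fundamental form $\mathbf{F}^*_k:R_{k-1}\to S^k\Omega^1_X$. Its dual is $\mathbf{F}_k$, and at a generic point $x$ it gives $\mathbf{F}_{k,x}:S^kT_x(X)\to R_{k-1}^*\otimes k(x)$. The third fundamental form is $\mathbf{III}=\mathbf{F}_3$,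 $\mathbf{III}_x=\mathbf{F}_{3,x}$. *)

(* Defs.v *)
From mathcomp Require Import all_boot all_order all_algebra.
From mathcomp Require Import perm.
From mathcomp Require Import classical_sets reals.
From mathcomp Require Import complex.
From mathcomp Require Import mpoly.

Set Implicit Arguments.
Unset Strict Implicit.
Unset Printing Implicit Defensive.

Import GRing.Theory.
Local Open Scope ring_scope.
Local Open Scope classical_set_scope.

(* A point of P^r is given by any of its nonzero coordinate vectors
   u : 'rV[K]_r.+1, so a subset of P^r is a set of nonzero vectors stable
   under nonzero scaling.  A line bundle section of degree e is a function of
   the coordinate vector, homogeneous of degree e; negative e is allowed. *)

Section Zariski.
Variables (K : closedFieldType) (r : nat).
Implicit Types (A X Z : set 'rV[K]_r.+1) (u v x : 'rV[K]_r.+1).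

Definition zclosed Z : Prop :=
  exists S : set {mpoly K[r.+1]},
    (forall F, S F -> exists d, F \is d.-homog) /\
    Z = [set u : 'rV[K]_r.+1 | u != 0 /\ forall F, S F -> F.@[u 0] = 0].

Definition zclosure A : set 'rV[K]_r.+1 :=
  [set u : 'rV[K]_r.+1 | forall Z, zclosed Z -> A `<=` Z -> Z u].

Definition zirreducible A : Prop :=
  A !=set0 /\
  forall Z1 Z2, zclosed Z1 -> zclosed Z2 ->
    A `<=` Z1 `|` Z2 -> A `<=` Z1 \/ A `<=` Z2.

(* Over an algebraically closed field, a reduced irreducible locally closed
   subscheme of P^r is the same thing as its set of closed points. *)
Definition quasi_projective_variety X : Prop :=
  (exists Z1 Z2, [/\ zclosed Z1, zclosed Z2 & X = Z1 `\` Z2]) /\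
  zirreducible X.

Definition irreducible_chain X (n : nat) (Y : nat -> set 'rV[K]_r.+1) : Prop :=
  (forall i, (i <= n)%N ->
     zirreducible (Y i) /\ exists2 Z, zclosed Z & Y i = X `&` Z) /\
  (forall i, (i < n)%N -> Y i `<=` Y i.+1 /\ Y i <> Y i.+1).

Definition has_dim X (n : nat) : Prop :=
  (exists Y, irreducible_chain X n Y) /\
  (forall m, (exists Y, irreducible_chain X m Y) -> (m <= n)%N).

(* The affine cone over the projective tangent space of X at x. *)
Definition proj_tangent X x : set 'rV[K]_r.+1 :=
  [set v : 'rV[K]_r.+1 |
    forall (d : nat) (F : {mpoly K[r.+1]}), F \is d.-homog ->
      (forall u, X u -> F.@[u 0] = 0) ->
      \sum_(i < r.+1) (F^`M(i)).@[x 0] * v 0 i = 0].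

(* Jacobian criterion: the projective tangent space has dimension dim X, that
   is, its cone is the row space of a matrix of rank dim X + 1. *)
Definition nonsingular X x : Prop :=
  X x /\
  exists n : nat, has_dim X n /\
    exists M : 'M[K]_(n.+1, r.+1),
      row_free M /\ forall v, proj_tangent X x v <-> (v <= M)%MS.

Definition tangent_variety X : set 'rV[K]_r.+1 :=
  zclosure [set v : 'rV[K]_r.+1 |
    v != 0 /\ exists2 x, nonsingular X x & proj_tangent X x v].

Definition secant_variety X : set 'rV[K]_r.+1 :=
  zclosure [set w : 'rV[K]_r.+1 | w != 0 /\ exists x y : 'rV[K]_r.+1,
    [/\ X x, X y, (forall c : K, y <> c *: x) &
        exists a b : K, w = a *: x + b *: y]].

(* P holds on a nonempty relatively open subset of X. *)
Definition generically X (P : 'rV[K]_r.+1 -> Prop) : Prop :=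
  exists Z, [/\ zclosed Z, (X `\` Z) !=set0 & forall x, (X `\` Z) x -> P x].

End Zariski.

Section PrincipalParts.
Variables (K : closedFieldType) (r : nat).
Implicit Types (X : set 'rV[K]_r.+1) (x : 'rV[K]_r.+1).

Local Notation fun1 := ('rV[K]_r.+1 -> K).
Local Notation fun2 := ('rV[K]_r.+1 -> 'rV[K]_r.+1 -> K).

Definition near1 X x (P : 'rV[K]_r.+1 -> Prop) : Prop :=
  exists (d : nat) (H : {mpoly K[r.+1]}),
    [/\ H \is d.-homog, H.@[x 0] != 0 &
        forall u, X u -> H.@[u 0] != 0 -> P u].

(* f represents an element of the stalk at x of O_X(e). *)
Definition stalk1 (e : int) X x (f : fun1) : Prop :=
  exists (d1 d2 : nat) (G H : {mpoly K[r.+1]}),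
    [/\ d1%:Z = d2%:Z + e, G \is d1.-homog, H \is d2.-homog, H.@[x 0] != 0 &
        forall u, X u -> H.@[u 0] != 0 -> f u = G.@[u 0] / H.@[u 0]].

Definition bihomog (d1 d2 : nat) (F : {mpoly K[r.+1 + r.+1]}) : Prop :=
  forall m, m \in msupp F ->
    (\sum_(i < r.+1) m (lshift r.+1 i))%N = d1 /\
    (\sum_(i < r.+1) m (rshift r.+1 i))%N = d2.

Definition meval2 (F : {mpoly K[r.+1 + r.+1]}) (u v : 'rV[K]_r.+1) : K :=
  F.@[row_mx u v 0].

(* "for all (u, v) in X x X near the diagonal point (x, x)" *)
Definition near2 X x (P : 'rV[K]_r.+1 -> 'rV[K]_r.+1 -> Prop) : Prop :=
  exists (a b : nat) (H : {mpoly K[r.+1 + r.+1]}),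
    [/\ bihomog a b H, meval2 H x x != 0 &
        forall u v, X u -> X v -> meval2 H u v != 0 -> P u v].

(* f represents an element of the stalk at (x, x) of the sheaf
   pr_1^* O_X(e1) (x) pr_2^* O_X(e2).  Functions suffice because X x X is
   reduced. *)
Definition stalk2 (e1 e2 : int) X x (f : fun2) : Prop :=
  exists (a1 a2 b1 b2 : nat) (G H : {mpoly K[r.+1 + r.+1]}),
    [/\ a1%:Z = b1%:Z + e1 /\ a2%:Z = b2%:Z + e2,
        bihomog a1 a2 G, bihomog b1 b2 H, meval2 H x x != 0 &
        forall u v, X u -> X v -> meval2 H u v != 0 ->
          f u v = meval2 G u v / meval2 H u v].

Definition diag_ideal X x (f : fun2) : Prop :=
  stalk2 0 0 X x f /\ near1 X x (fun u => f u u = 0).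

(* phi = \sum_m c_m * \prod_(j < k) f_(m, j) as germs at (x, x), where the c_m
   are germs of pr_1^* L^* (x) pr_2^* L and the f_(m, j) lie in I_Delta. *)
Definition diag_expansion X x (k : nat) (phi : fun2)
    (N : nat) (c : 'I_N -> fun2) (f : 'I_N -> 'I_k -> fun2) : Prop :=
  [/\ forall m, stalk2 (-1) 1 X x (c m),
      forall m j, diag_ideal X x (f m j) &
      near2 X x (fun u v =>
        phi u v = \sum_(m < N) c m u v * \prod_(j < k) f m j u v)].

(* The sheaf P^k(L) (x) L^* is supported on the diagonal; its stalk at x is
   that of pr_1^* L^* (x) pr_2^* L at (x, x) modulo I_Delta^(k+1).  This says
   that the class of phi is zero. *)
Definition principal_part_eq0 X x (k : nat) (phi : fun2) : Prop :=
  exists (N : nat) (c : 'I_N -> fun2) (f : 'I_N -> 'I_k.+1 -> fun2),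
    diag_expansion X x phi c f.

(* A germ \sum_i 'X_i (x) b_i of V (x) L^* is given by the family b of germs of
   L^*, the homogeneous coordinates 'X_i being a basis of V.  Since d^k_L is
   induced by pr_2, the map alpha_k (x) L^* sends it to the class of the
   following function, for every k. *)
Definition taylor (b : 'I_r.+1 -> fun1) : fun2 :=
  fun u v => \sum_(i < r.+1) b i u * v 0 i.

(* The stalk at x of R_k = ker alpha_k (x) L^*. *)
Definition Rstalk X x (k : nat) (b : 'I_r.+1 -> fun1) : Prop :=
  (forall i, stalk1 (-1) X x (b i)) /\ principal_part_eq0 X x k (taylor b).

(* T_x(X), as the space of K-derivations O_(X,x) -> k(x) = K. *)
Definition tangent_vector X x (t : fun1 -> K) : Prop :=
  [/\ forall f g, stalk1 0 X x f -> stalk1 0 X x g ->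
        near1 X x (fun u => f u = g u) -> t f = t g,
      forall (a : K) f g, stalk1 0 X x f -> stalk1 0 X x g ->
        t (fun u => a * f u + g u) = a * t f + t g &
      forall f g, stalk1 0 X x f -> stalk1 0 X x g ->
        t (fun u => f u * g u) = f x * t g + g x * t f].

(* fundamental_form X x b t z: the linear form F_(k,x)(t_0 ... t_(k-1)) on
   R_(k-1) takes the value z at the germ b.
   The form F^*_k(b) is the class of taylor b in
   I_Delta^k / I_Delta^(k+1) = S^k Omega^1_X, where the class of f in
   I_Delta / I_Delta^2 = Omega^1_X evaluates at a tangent vector t at x to
   t (f (x, -)), and a product of k one-forms is paired with t_0 ... t_(k-1) by
   the permanent.  At a nonsingular x the value z does not depend on the chosen
   expansion of taylor b.  Where R_(k-1) is locally free, in particular at a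
   generic x, R_(k-1)^* (x) k(x) is the dual of R_(k-1) (x) k(x), so its
   elements are determined by their values on germs of R_(k-1). *)
Definition fundamental_form X x (k : nat) (b : 'I_r.+1 -> fun1)
    (t : 'I_k -> fun1 -> K) (z : K) : Prop :=
  exists (N : nat) (c : 'I_N -> fun2) (f : 'I_N -> 'I_k -> fun2),
    diag_expansion X x (taylor b) c f /\
    z = \sum_(m < N) c m x x *
          \sum_(s : 'S_k) \prod_(j < k) t (s j) (f m j x).

(* F_(k,x) = 0; the products of tangent vectors span S^k T_x(X). *)
Definition fundamental_form_eq0 (k : nat) X x : Prop :=
  forall (b : 'I_r.+1 -> fun1) (t : 'I_k -> fun1 -> K) (z : K),
    Rstalk X x k.-1 b -> (forall j, tangent_vector X x (t j)) ->
    fundamental_form X x b t z -> z = 0.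

Definition third_fundamental_form_eq0 X x : Prop :=
  fundamental_form_eq0 3 X x.

End PrincipalParts.

(* Main.v *)
Require Import Defs.
From HB Require Import structures.
From mathcomp Require Import all_boot all_order all_algebra.
From mathcomp Require Import perm fingroup.
From mathcomp Require Import boolp classical_sets reals.
From mathcomp Require Import complex.
From mathcomp Require Import mpoly ring.

(* Work at the generic point of X, with derivations of function fields instead
   of charts.  Let D be a vector field tangent to the affine cone over X, and
   let x(t) = x + t Dx + t^2/2 D^2 x + ... be its integral curve.  The chords
   (x(t) - x)/t lie on the cone over Sec(X) = tau(X); a homogeneous equation G
   of tau(X) vanishes on them, and comparing the coefficient of t^2 with
   D^2 (G(Dx)) = 0 gives dG(D^3 x) = 0 at the point Dx of tau(X).  So D^3 x is
   tangent to tau(X) at the point Dx.  In characteristic 0 a vector tangent to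
   the image of a map at a generic point is the image of a tangent vector of
   the source (derivations extend along field extensions), and differentiating
   (x, s) |-> \sum_j s_j D_j x shows that D^3 x is a combination of the vectors
   D_j x and D_i D_j x.  Hence a linear form vanishing on X to order 3 at a
   generic x kills D^3 x for all D, and III_x = 0 by polarization. *)

Set Implicit Arguments.
Unset Strict Implicit.
Unset Printing Implicit Defensive.

Import GRing.Theory.
Local Open Scope ring_scope.
Local Open Scope quotient_scope.
Local Open Scope classical_set_scope.

(** * Function fields *)

(** The map (x, s) |-> \sum_j s_j V_j(x), dominant onto the cone over tau(X), can have fibres of
    positive dimension, so a tangent vector of tau(X) has no canonical lift. Once it is read as a
    derivation with values in the function field of the tangent bundle, lifting becomes extension of
    derivations, which works in characteristic 0 whatever the fibres are. Points are coordinate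
    vectors, so everything lives on affine cones: there are n + 1 fields V_j, and inhomogeneous
    polynomials occur as denominators. A condition stated with them depends on the representative of
    a projective point; it is met by some multiple of the point, and the conclusion is carried back
    by a homothety. tau(X) involves all nonsingular points, while the V_j are known to span tangent
    spaces only where their common denominator is nonzero; primality of the ideal of X bridges the
    difference. *)

Section ResidueField.
Variables (P : comNzRingType) (I : prime_idealr P).

Local Notation Q := {ideal_quot I}.

(** Invertibility in the quotient is undecidable, so inverses are chosen classically; a non-unit is
    its own inverse, the default value that the unit-ring axioms require. *)
Let unitq : pred Q := fun x => `[<exists y, y * x = 1>].
Let invq (x : Q) : Q :=
  if pselect (exists y, y * x = 1) is left h then sval (cid h) else x.

Fact mulVq : {in unitq, left_inverse 1 invq *%R}.
Proof.
move=> x /asboolP ux; rewrite /invq; case: pselect => // h.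
by case: (cid h).
Qed.

Fact unitqP (x y : Q) : y * x = 1 -> unitq x.
Proof. by move=> h; apply/asboolP; exists y. Qed.

Fact invq_out : {in [predC unitq], invq =1 id}.
Proof.
move=> x /asboolP ux; rewrite /invq; case: pselect => // h.
Qed.

HB.instance Definition _ :=
  GRing.ComNzRing_hasMulInverse.Build Q mulVq unitqP invq_out.
HB.instance Definition _ :=
  GRing.ComUnitRing_isIntegral.Build Q (@Quotient.rquot_IdomainAxiom P I).

Lemma residue_field_ex : exists (L : fieldType) (phi : {rmorphism P -> L}),
  (forall p, (phi p == 0) = (p \in I)) /\
  (forall z, exists p q, phi q != 0 /\ z = phi p / phi q).
Proof.
exists {fraction Q}, (@tofrac Q \o \pi_Q); split=> [p|z].
  by rewrite /= tofrac_eq0 -(rmorph0 (\pi_Q : {rmorphism P -> Q})) -Quotient.idealrBE subr0.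
elim/quotW: z => x; set a := \n_x; set b := \d_x.
have b0 : tofrac b != 0 by rewrite tofrac_eq0 denom_ratioP.
exists (generic_quotient.repr a), (generic_quotient.repr b); rewrite /= !reprK; split=> //.
apply: (mulIf b0); rewrite mulfVK //.
rewrite /FracField.tofrac; unlock.
rewrite -[LHS]FracField.pi_mul; apply/eqmodP.
rewrite /= FracField.equivfE /FracField.mulf /=.
by rewrite !numden_Ratio ?mulf_neq0 ?oner_neq0 ?denom_ratioP // !mulr1 mulrC.
Qed.

End ResidueField.

(** Ideals of functions vanishing on a set are predicates in [Prop]; their classical boolean
    reflection is the prime ideal divided out. Both [X] and its tangent bundle are treated this
    way. *)
Lemma function_field (P : comNzRingType) (I : P -> Prop) :
  I 0 -> ~ I 1 -> (forall a u v, I u -> I v -> I (a * u + v)) ->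
  (forall u v, I (u * v) -> I u \/ I v) ->
  exists (L : fieldType) (phi : {rmorphism P -> L}),
    (forall p, phi p = 0 <-> I p) /\
    (forall z, exists p q, phi q <> 0 /\ z = phi p / phi q).
Proof.
move=> I0 I1 IL IM; pose S : {pred P} := fun x => `[<I x>].
have SP x : reflect (I x) (x \in S) by exact: asboolP.
have idS : idealr_closed S.
  split; [exact/SP|exact/SP|]=> a u v /SP Iu /SP Iv; apply/SP; exact: IL.
have prS : prime_idealr_closed S.
  by move=> u v /SP /IM[]/SP->//; rewrite orbT.
pose SI : idealr P := HB.pack (S : P -> bool) (isIdealr.Build P S idS).
pose SJ : prime_idealr P := HB.pack (S : P -> bool) SI (isPrimeIdealrClosed.Build P S prS).
have [L [phi [h1 h2]]] := residue_field_ex SJ.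
exists L, phi; split=> [p|z].
  by split=> [/eqP|/SP]; rewrite ?h1 => /SP// /SP; rewrite -h1 => /eqP.
by have [p [q [/eqP q0 ->]]] := h2 z; exists p, q.
Qed.

(** * Extension of derivations *)

Definition derivation (B : comNzRingType) (D : B -> B) : Prop :=
  {morph D : x y / x + y} /\ forall x y, D (x * y) = x * D y + y * D x.

Section DerivationTheory.
Variables (B : comNzRingType) (D : B -> B) (dD : derivation D).

Lemma drvD x y : D (x + y) = D x + D y. Proof. exact: dD.1. Qed.

Lemma drvM x y : D (x * y) = x * D y + y * D x. Proof. exact: dD.2. Qed.

Lemma drv0 : D 0 = 0.
Proof. by apply: (addrI (D 0)); rewrite -drvD !addr0. Qed.

Lemma drvN x : D (- x) = - D x.
Proof. by apply: (addrI (D x)); rewrite -drvD !addrN drv0. Qed.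

Lemma drvB x y : D (x - y) = D x - D y.
Proof. by rewrite drvD drvN. Qed.

Lemma drv_sum (I : Type) (s : seq I) (Q : pred I) (F : I -> B) :
  D (\sum_(i <- s | Q i) F i) = \sum_(i <- s | Q i) D (F i).
Proof. exact: (big_morph D drvD drv0). Qed.

End DerivationTheory.

Section DerivationExtension.
Variable L : fieldType.
Hypothesis char0 : forall n, (n.+1%:R : L) != 0.
Implicit Types M G : set (L * L).

(* The graph of a derivation on a subring of L is a subring of the dual
   numbers L[e], seen as L * L, on which the first projection is injective. *)
Definition dual_graph M : Prop :=
  [/\ M (1, 0),
      forall a b, M a -> M b -> M (a.1 - b.1, a.2 - b.2),
      forall a b, M a -> M b -> M (a.1 * b.1, a.1 * b.2 + b.1 * a.2) &
      forall b, M (0, b) -> b = 0].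

Section Adjoin.
Variables (M : set (L * L)) (gM : dual_graph M) (z : L).

(** [q] is [p] with the derivation applied to each coefficient. *)
Definition dual_poly (p q : {poly L}) : Prop := forall k, M (p`_k, q`_k).

Let M1 : M (1, 0). Proof. by case: gM. Qed.
Let MB a b : M a -> M b -> M (a.1 - b.1, a.2 - b.2).
Proof. by case: gM => _ + _ _; apply. Qed.
Let MM a b : M a -> M b -> M (a.1 * b.1, a.1 * b.2 + b.1 * a.2).
Proof. by case: gM => _ _ + _; apply. Qed.
Let M0 : M (0, 0).
Proof. by have := MB M1 M1; rewrite /= !subrr. Qed.
Let MD a b : M a -> M b -> M (a.1 + b.1, a.2 + b.2).
Proof.
move=> Ma Mb; have := MB Ma (MB M0 Mb).
by rewrite /= !sub0r !opprK.
Qed.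
Let Mnat n : M (n%:R, 0).
Proof.
elim: n => [|n IH]; first exact: M0.
by have := MD M1 IH; rewrite /= addr0 -natr1 addrC.
Qed.
Let Msum (I : Type) (s : seq I) (F G : I -> L) :
  (forall i, M (F i, G i)) -> M (\sum_(i <- s) F i, \sum_(i <- s) G i).
Proof.
move=> FG; elim: s => [|i s IH]; first by rewrite !big_nil; exact: M0.
by rewrite !big_cons; exact: MD (FG i) IH.
Qed.

Lemma dual_polyC a b : M (a, b) -> dual_poly a%:P b%:P.
Proof. by move=> Mab k; rewrite !coefC; case: eqP => // _; exact: M0. Qed.

Lemma dual_polyX : dual_poly 'X 0.
Proof.
by move=> k; rewrite coefX coef0; case: eqP => _; [exact: M1|exact: M0].
Qed.

Lemma dual_polyB p q p' q' :
  dual_poly p q -> dual_poly p' q' -> dual_poly (p - p') (q - q').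
Proof. by move=> h h' k; rewrite !coefB; exact: MB (h k) (h' k). Qed.

Lemma dual_polyM p q p' q' :
  dual_poly p q -> dual_poly p' q' -> dual_poly (p * p') (p * q' + p' * q).
Proof.
move=> h h' k; rewrite coefD [p' * q]mulrC !coefM -big_split /=.
apply: Msum => i; have := MM (h i) (h' (k - i)%N).
by rewrite /= [_ * q`_i]mulrC.
Qed.

Lemma dual_poly_deriv p q : dual_poly p q -> dual_poly p^`() q^`().
Proof.
move=> h k; rewrite !coef_deriv; have := MM (h k.+1) (Mnat k.+1).
by rewrite /= mulr0 add0r mulr_natr mulr_natl.
Qed.

Lemma dual_poly0 q : dual_poly 0 q -> q = 0.
Proof.
move=> h; apply/polyP => k; have := h k; rewrite !coef0.
by case: gM => _ _ _; apply.
Qed.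

Lemma dual_adjoin_value : exists c, forall p q, dual_poly p q ->
  p.[z] = 0 -> q.[z] + c * p^`().[z] = 0.
Proof.
pose alg n := `[< exists p q, [/\ dual_poly p q, p.[z] = 0, p != 0 &
                                  size p = n] >].
have [[n0 algn0]|noalg] := pselect (exists n, alg n); last first.
  exists 0 => p q h pz; have p0 : p = 0.
    apply/eqP/negP => /negP p0; apply: noalg; exists (size p).
    by apply/asboolP; exists p, q.
  by rewrite p0 in h *; rewrite (dual_poly0 h) mul0r addr0 horner0.
have exn : exists n, alg n by exists n0.
case: (ex_minnP exn) => n /asboolP[p [q [hp pz p0 sp]]] minp.
have zp' : p^`().[z] != 0.
  apply/eqP => p'z.
  have [p'0|p'0] := eqVneq p^`() 0.
    have sp1 : size p = 1%N.
      apply/eqP; rewrite eqn_leq size_poly_gt0 p0 andbT leqNgt.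
      apply/negP => sp1.
      have := congr1 (fun f : {poly L} => f`_(size p).-2) p'0.
      have e : ((size p).-2.+1 = (size p).-1)%N by rewrite prednK // -subn1 subn_gt0.
      rewrite coef_deriv coef0 e.
      rewrite -mulr_natr => /eqP; rewrite mulf_eq0 -/(lead_coef p).
      rewrite lead_coef_eq0 (negPf p0) /=.
      by case: (size p) sp1 => [|[|m]] // _; rewrite /= (negPf (char0 m)).
    by move: p0 pz; rewrite (size1_polyC (eq_leq sp1)) hornerC polyC_eq0 => /eqP.
  have /minp : alg (size p^`()) 
    by apply/asboolP; exists p^`(), q^`(); split=> //; exact: dual_poly_deriv.
  by rewrite -sp leqNgt lt_size_deriv.
exists (- q.[z] / p^`().[z]); set c := - _ / _.
have qc : q.[z] + c * p^`().[z] = 0 by rewrite /c mulfVK // addrN.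
move=> f g; have [m] := ubnP (size f); elim: m f g => // m IH f g sf hf fz.
have [f0|f0] := eqVneq f 0.
  by rewrite f0 in hf *; rewrite (dual_poly0 hf) deriv0 !horner0 mulr0 addr0.
have spf : (size p <= size f)%N.
  by rewrite sp minp //; apply/asboolP; exists f, g.
set a := lead_coef p; set a' := q`_(size p).-1.
set b := lead_coef f; set b' := g`_(size f).-1.
set k := (size f - size p)%N.
(* One step of pseudo-division, whose leading terms cancel; [g1] is what the Leibniz rule gives for
   its coefficients. *)
pose f1 := a%:P * f - b%:P * ('X^k * p).
pose g1 := (a%:P * g + f * a'%:P) - (b%:P * ('X^k * q) + ('X^k * p) * b'%:P).
have dX j : dual_poly 'X^j 0.
  elim: j => [|j IHj]; first by rewrite expr0; exact: (dual_polyC M1).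
  by have := dual_polyM dual_polyX IHj; rewrite !mulr0 addr0 -exprS.
have hfg : dual_poly f1 g1.
  apply: dual_polyB.
    exact: dual_polyM (dual_polyC (hp _)) hf.
  apply: dual_polyM (dual_polyC (hf _)) _.
  by have := dual_polyM (dX k) hp; rewrite mulr0 addr0.
have f1z : f1.[z] = 0 by rewrite hornerD hornerN !hornerM fz pz !mulr0 subrr.
have sf1 : (size f1 < m)%N.
  rewrite ltnS in sf; apply: leq_trans sf.
  have a0 : a != 0 by rewrite lead_coef_eq0.
  have b0 : b != 0 by rewrite lead_coef_eq0.
  have sf1 : (size f1 <= size f)%N.
    rewrite (leq_trans (size_polyD _ _)) // size_polyN geq_max.
    rewrite !mul_polyC !size_scale // leqnn /= mulrC size_mulXn //.
    by rewrite subnK.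
  rewrite ltn_neqAle sf1 andbT; apply/eqP => e.
  have : f1 = 0.
    apply/eqP; rewrite -lead_coef_eq0 lead_coefE e.
    rewrite !coefB !mul_polyC !coefZ coefXnM -/b.
    have sf0 : (0 < size f)%N by rewrite size_poly_gt0.
    have sp0 : (0 < size p)%N by rewrite size_poly_gt0.
    have -> : ((size f).-1 < k)%N = false.
      by apply/negbTE; rewrite -leqNgt -ltnS prednK // /k ltn_subrL sf0 sp0.
    have -> : ((size f).-1 - k = (size p).-1)%N.
      by rewrite /k -(subnK spf) -!subn1 addnK -addnBA // addKn.
    by rewrite -/a -/(lead_coef f) -/b mulrC subrr.
  by move=> f10; move: e f0; rewrite f10 size_poly0 -size_poly_eq0 => <-.
have := IH _ _ sf1 hfg f1z.
have -> : g1.[z] + c * f1^`().[z] = a * (g.[z] + c * f^`().[z]).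
  rewrite /g1 /f1 derivB !derivM !derivC !(hornerD, hornerN, hornerM, hornerC, hornerXn) fz pz.
  transitivity (a * (g.[z] + c * f^`().[z]) - b * z ^+ k * (q.[z] + c * p^`().[z])).
    ring.
  by rewrite qc mulr0 subr0.
by move/eqP; rewrite mulf_eq0 lead_coef_eq0 (negPf p0) => /eqP.
Qed.

End Adjoin.

(** A maximal graph is total, because p(z) |-> q(z) + c p'(z) extends it to any further [z]. *)
Lemma derivation_extension M : dual_graph M ->
  exists D : L -> L, derivation D /\ forall a, M a -> D a.1 = a.2.
Proof.
move=> gM.
(* Zorn is applied to the sets adjoined to [M], so that the empty chain has the bound [M]. *)
have [F Ftot FP|A [gA maxA]] := @Zorn_bigcup _ (fun A : set (L * L) => dual_graph (M `|` A)).
  have chain a b : (M `|` \bigcup_(X in F) X) a -> (M `|` \bigcup_(X in F) X) b ->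
     exists N, [/\ dual_graph N, N `<=` M `|` \bigcup_(X in F) X, N a & N b].
    have sub X : F X -> M `|` X `<=` M `|` \bigcup_(X in F) X.
      by move=> FX c [Mc|Xc]; [left|right; exists X].
    move=> [Ma|[X FX Xa]] [Mb|[Y FY Yb]].
    - by exists M; split=> // c Mc; left.
    - by exists (M `|` Y); split; [exact: Ftot|exact: sub|left|right].
    - by exists (M `|` X); split; [exact: Ftot|exact: sub|right|left].
    - case: (FP _ _ FX FY) => XY.
        by exists (M `|` Y); split; [exact: Ftot|exact: sub|right; exact: XY|right].
      by exists (M `|` X); split; [exact: Ftot|exact: sub|right|right; exact: XY].
  split.
  - by left; case: gM.
  - by move=> a b /chain h /h[N [[_ + _ _] sN Na Nb]] => /(_ _ _ Na Nb) /sN.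
  - by move=> a b /chain h /h[N [[_ _ + _] sN Na Nb]] => /(_ _ _ Na Nb) /sN.
  - by move=> b h; have [N [[_ _ _ +] sN Na Nb]] := chain _ _ h h; apply.
set N := M `|` A in gA.
have total z : exists c, N (z, c).
  have [c hc] := dual_adjoin_value gA z.
  pose N' : set (L * L) := fun a => exists p q,
    [/\ dual_poly N p q, a.1 = p.[z] & a.2 = q.[z] + c * p^`().[z]].
  have NN' : N `<=` N'.
    move=> [a b] Nab; exists a%:P, b%:P; split; first exact: dual_polyC.
      by rewrite hornerC.
    by rewrite derivC hornerC horner0 mulr0 addr0.
  have gN' : dual_graph N'.
    split.
    - by apply: NN'; case: gA.
    - move=> a b [p [q [h -> ->]]] [p' [q' [h' -> ->]]].
      exists (p - p'), (q - q'); split; first exact: dual_polyB.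
        by rewrite ?(hornerD, hornerN, hornerM).
      by rewrite derivB !hornerD !hornerN /=; ring.
    - move=> a b [p [q [h -> ->]]] [p' [q' [h' -> ->]]].
      exists (p * p'), (p * q' + p' * q); split; first exact: dual_polyM.
        by rewrite ?(hornerD, hornerN, hornerM).
      by rewrite derivM !hornerD !hornerM /=; ring.
    - by move=> b [p [q [h /= /esym pz ->]]]; exact: hc.
  have NzN' : N' (z, c).
    exists 'X, 0; split; first exact: dual_polyX.
      by rewrite /= hornerX.
    by rewrite /= derivX horner0 hornerC add0r mulr1.
  exists c; apply: contrapT => nN; apply: (maxA N').
    split; first by move=> a Aa; apply: NN'; right.
    by move=> /(_ _ NzN') h; apply: nN; right.
  suff -> : M `|` N' = N' by [].
  by apply/seteqP; split=> [a [Ma|//]|a N'a]; [apply: NN'; left|right].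
have [_ NB NM Ninj] := gA.
have uniqN a b c : N (a, b) -> N (a, c) -> b = c.
  move=> hb hc; apply/eqP; rewrite -subr_eq0; apply/eqP/Ninj.
  by have := NB _ _ hb hc; rewrite /= subrr.
have /choice[D HD] := total.
have N0 : N (0, 0) by have := NB _ _ (HD 0) (HD 0); rewrite /= !subrr.
exists D; split; last first.
  by move=> [a b] Mab /=; apply: uniqN (HD a) _; left.
split=> x y.
  apply: uniqN (HD _) _; have := NB _ _ (HD x) (NB _ _ N0 (HD y)).
  by rewrite /= !sub0r !opprK.
exact: uniqN (HD _) (NM _ _ (HD x) (HD y)).
Qed.

End DerivationExtension.

(** * Polynomials and substitutions *)

Section PolynomialSubstitution.
Variables (n : nat) (K : comNzRingType).

Lemma mpoly_ring_ind (Q : {mpoly K[n]} -> Prop) :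
  (forall c, Q c%:MP) -> (forall i, Q 'X_i) ->
  (forall p q, Q p -> Q q -> Q (p + q)) ->
  (forall p q, Q p -> Q q -> Q (p * q)) -> forall p, Q p.
Proof.
move=> QC QX QD QM; elim/mpolyind => [|c m p _ _ Qp]; first by rewrite -mpolyC0.
apply/QD => //; rewrite -mul_mpolyC; apply/QM => //; rewrite mpolyXE_id.
apply: (big_ind Q) => [|u v|i _]; [by rewrite -mpolyC1|exact: QM|].
elim: (m i) => [|k IH]; first by rewrite expr0 -mpolyC1.
by rewrite exprS; apply: QM.
Qed.

Lemma mderivXU i j : ('X_j : {mpoly K[n]})^`M(i) = (j == i)%:R.
Proof.
rewrite mderivX mnm1E; case: eqP => [->|_]; last by rewrite scale0r.
have -> : (U_(i) - U_(i))%MM = 0%MM :> 'X_{1..n}.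
  by apply/mnmP => k; rewrite mnmBE subnn mnm0E.
by rewrite scale1r mpolyX0.
Qed.

Lemma rmorph_mmap (B C : comNzRingType) (psi : {rmorphism B -> C})
    (c : {rmorphism K -> B}) (c' : {rmorphism K -> C}) (b : 'I_n -> B)
    (b' : 'I_n -> C) G :
  (forall a, psi (c a) = c' a) -> (forall i, psi (b i) = b' i) ->
  psi (mmap c b G) = mmap c' b' G.
Proof.
move=> hc hb; elim/mpoly_ring_ind: G => [a|i|p q hp hq|p q hp hq].
- by rewrite !mmapC hc.
- by rewrite !mmapX !mmap1U hb.
- by rewrite !mmapD rmorphD hp hq.
- by rewrite !rmorphM /= hp hq.
Qed.

Lemma meval_mmap (C : comNzRingType) (psi : {rmorphism {mpoly K[n]} -> C}) G :
  psi G = mmap (psi \o @mpolyC n K) (fun i => psi 'X_i) G.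
Proof.
elim/mpoly_ring_ind: G => [a|i|p q hp hq|p q hp hq].
- by rewrite !mmapC.
- by rewrite !mmapX !mmap1U.
- by rewrite !mmapD rmorphD hp hq.
- by rewrite !rmorphM /= hp hq.
Qed.

Lemma derivation_mmap (B : comNzRingType) (D : B -> B)
    (c : {rmorphism K -> B}) (b : 'I_n -> B) G :
  derivation D -> (forall a, D (c a) = 0) ->
  D (mmap c b G) = \sum_(k < n) mmap c b (G^`M(k)) * D (b k).
Proof.
move=> dD Dc; elim/mpoly_ring_ind: G => [a|i|p q hp hq|p q hp hq].
- rewrite mmapC Dc big1 // => k _; by rewrite mderivC mmap0 mul0r.
- rewrite mmapX mmap1U (bigD1 i) //= big1 ?addr0 => [|k ki].
    by rewrite mderivXU eqxx rmorph1 mul1r.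
  by rewrite mderivXU eq_sym (negPf ki) rmorph0 mul0r.
- rewrite !mmapD (drvD dD) hp hq -big_split /=; apply: eq_bigr => k _.
  by rewrite mderivD mmapD mulrDl.
- rewrite !rmorphM /= (drvM dD) hp hq !mulr_sumr -big_split /=.
  apply: eq_bigr => k _; rewrite mderivM mmapD !rmorphM /=; ring.
Qed.

Lemma mmap_homog (B : comNzRingType) (c : {rmorphism K -> B}) (b : 'I_n -> B)
    (t : B) d G : G \is d.-homog ->
  mmap c (fun i => t * b i) G = t ^+ d * mmap c b G.
Proof.
move=> /dhomogP hG; rewrite /mmap mulr_sumr !big_seq; apply: eq_bigr => m mG.
have <- : mdeg m = d := hG _ mG.
rewrite [RHS]mulrCA; congr (_ * _); rewrite /mmap1 mdegE.
rewrite expr_sum -big_split /=; apply: eq_bigr => i _; exact: exprMn.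
Qed.

Lemma eq_mmap (B : comNzRingType) (c c' : K -> B) (b b' : 'I_n -> B) G :
  c =1 c' -> b =1 b' -> mmap c b G = mmap c' b' G.
Proof.
move=> hc hb; apply: eq_bigr => m _; rewrite hc; congr (_ * _).
by apply: eq_bigr => i _; rewrite hb.
Qed.

Lemma meval_homog (v : 'I_n -> K) t d (G : {mpoly K[n]}) : G \is d.-homog ->
  G.@[fun i => t * v i] = t ^+ d * G.@[v].
Proof. exact: mmap_homog. Qed.

End PolynomialSubstitution.

(** * Polynomials along lines in characteristic zero *)

Section CharacteristicZero.
Variable K : idomainType.
Hypothesis char0 : forall n, (n.+1%:R : K) != 0.

Lemma natr_inj_char0 : injective (fun n : nat => n%:R : K).
Proof.
suff h a b : (a <= b)%N -> a%:R = b%:R :> K -> a = b.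
  move=> a b /= e; have [ab|ba] := leqP a b; first exact: h.
  by apply/esym/h => //; exact: ltnW.
move=> ab /eqP; rewrite -(subnKC ab) natrD -subr_eq0 opprD addrA subrr sub0r.
by rewrite oppr_eq0; case: (b - a)%N => [|k]; rewrite ?addn0 // (negPf (char0 k)).
Qed.

Lemma poly_eq0_char0 (p : {poly K}) : (forall x, p.[x] = 0) -> p = 0.
Proof.
move=> h; apply/eqP/negP => /negP p0.
have := max_poly_roots p0 (rs := [seq i%:R | i <- iota 0 (size p)]).
rewrite size_map size_iota ltnn map_inj_uniq ?iota_uniq; last exact: natr_inj_char0.
move=> F; suff : false by []. apply: F => //; apply/allP => x _; exact/rootP/h.
Qed.

Lemma poly_neq0_val (p : {poly K}) : p <> 0 -> exists2 x, x != 0 & p.[x] != 0.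
Proof.
move=> p0; apply: contrapT => h; have : 'X * p = 0.
  apply: poly_eq0_char0 => x; rewrite hornerM hornerX; apply/eqP; rewrite mulf_eq0.
  by apply: contraT => /norP[x0 px]; case: h; exists x.
by move/eqP; rewrite mulf_eq0 polyX_eq0 => /eqP.
Qed.

Variable n : nat.
Implicit Types (G : {mpoly K[n]}) (v w : 'I_n -> K).

Lemma meval_line v w G : exists p : {poly K},
  forall t, p.[t] = G.@[fun i => v i + t * w i].
Proof.
exists (mmap (@polyC K) (fun i => (v i)%:P + (w i)%:P * 'X) G) => t.
rewrite -[_.[t]]/(horner_eval t _).
apply: rmorph_mmap => [a|i]; rewrite /= /horner_eval ?hornerC //.
by rewrite hornerD hornerM !hornerC hornerX mulrC.
Qed.

(** Along the line through [v], the values of the homogeneous components at [v] are the coefficients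
    of a polynomial in t. *)
Lemma meval_homog_comp v G :
  (forall t, t != 0 -> G.@[fun i => t * v i] = 0) ->
  forall d, (pihomog [measure of mdeg] d G).@[v] = 0.
Proof.
move=> h d; set c := fun e : nat => (pihomog [measure of mdeg] e G).@[v].
(* The bound also exceeds [d], so that the coefficient of index [d] can be read off even beyond the
   degree of [G]. *)
pose N := maxn (msize G) d.+1; pose p := \poly_(e < N) c e.
have p0 : p = 0.
  apply: contrapT => /poly_neq0_val[t t0 /eqP]; apply.
  rewrite horner_poly -[RHS](h t t0).
  rewrite [in RHS](pihomog_partitionE (mf := [measure of mdeg]) (leq_maxl (msize G) d.+1)).
  rewrite raddf_sum /=; apply: eq_bigr => e _.
  by rewrite (meval_homog _ _ (pihomogP _ _ _)) mulrC.
by have := congr1 (fun q : {poly K} => q`_d) p0; rewrite coef_poly leq_maxr coef0.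
Qed.

End CharacteristicZero.

(** * Integral curves of vector fields *)

Section VectorFields.
Variables (K : fieldType) (n : nat).
Implicit Types (F G : {mpoly K[n]}) (w : 'I_n -> {mpoly K[n]}).

Definition vfield w F : {mpoly K[n]} := \sum_(k < n) w k * F^`M(k).

Lemma vfield_derivation w : derivation (vfield w).
Proof.
split=> F G; rewrite /vfield.
  by rewrite -big_split /=; apply: eq_bigr => k _; rewrite mderivD mulrDr.
rewrite !mulr_sumr -big_split /=; apply: eq_bigr => k _.
rewrite mderivM; ring.
Qed.

Fact vfield_is_zmod_morphism w : zmod_morphism (vfield w).
Proof. by move=> F G; exact: (drvB (vfield_derivation w)). Qed.

HB.instance Definition _ w := GRing.isZmodMorphism.Build {mpoly K[n]} {mpoly K[n]}
  (vfield w) (vfield_is_zmod_morphism w).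

Lemma vfieldC w c : vfield w c%:MP = 0.
Proof. by apply: big1 => k _; rewrite mderivC mulr0. Qed.

Lemma vfieldX w i : vfield w 'X_i = w i.
Proof.
rewrite /vfield (bigD1 i) //= big1 ?addr0 => [|k ki].
  by rewrite mderivXU eqxx mulr1.
by rewrite mderivXU eq_sym (negPf ki) mulr0.
Qed.

Lemma vfieldZ w c F : vfield w (c *: F) = c *: vfield w F.
Proof.
rewrite /vfield scaler_sumr; apply: eq_bigr => k _.
by rewrite mderivZ scalerAr.
Qed.

Definition vanish (X : set 'rV[K]_n) F : Prop := forall u, X u -> F.@[u 0] = 0.

Hypothesis char0 : forall m, (m.+1%:R : K) != 0.

Section Arc.
Variables (w : 'I_n -> {mpoly K[n]}) (X : set 'rV[K]_n).
Hypothesis tangent_w : forall F, vanish X F -> vanish X (vfield w F).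
Let dw := vfield_derivation w.

(* The integral curve of the vector field w through the generic point, as a
   power series truncated at order N. *)
Definition arc (N : nat) (i : 'I_n) : {poly {mpoly K[n]}} :=
  \poly_(j < N.+1) ((j`!%:R)^-1 *: iter j (vfield w) 'X_i).

Let Dt (q : {poly {mpoly K[n]}}) := q^`() - map_poly (vfield w) q.

Let coefDt q j : (Dt q)`_j = q`_j.+1 *+ j.+1 - vfield w q`_j.
Proof. by rewrite coefB coef_deriv coef_map. Qed.

Let Dt_derivation : derivation Dt.
Proof.
split=> p q; rewrite /Dt; first by rewrite derivD raddfD /=; ring.
rewrite derivM; suff -> : map_poly (vfield w) (p * q) =
    p * map_poly (vfield w) q + q * map_poly (vfield w) p by ring.
apply/polyP => j; rewrite [q * _]mulrC coefD coef_map !coefM.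
rewrite raddf_sum -big_split /=; apply: eq_bigr => i _.
by rewrite !coef_map /= (drvM dw) [_`_(_ - _) * _]mulrC.
Qed.

(** The operator [Dt], that is d/dt - w, is a derivation that kills constants and, below order [N],
    the coordinates of the curve. Hence it kills F along the curve below that order, which reads
    (k+1) q_(k+1) = w q_k with q_0 = F; tangency of [w] propagates the vanishing. *)
Lemma arc_vanish N F : vanish X F -> forall k, (k <= N)%N ->
  vanish X (mmap (@polyC _ \o @mpolyC n K) (arc N) F)`_k.
Proof.
move=> F0; set q := mmap _ _ F.
have q0 : q`_0 = F.
  rewrite -horner_coef0 -[_.[0]]/(horner_eval 0 _).
  rewrite (rmorph_mmap (c' := @mpolyC n K) (b' := fun i => 'X_i)).
  - by rewrite -{2}[F]comp_mpoly_id /comp_mpoly; apply: eq_mmap => // i; rewrite tnth_mktuple.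
  - by move=> a; rewrite /= /horner_eval hornerC.
  - move=> i; rewrite /= /horner_eval horner_coef0 coef_poly /= fact0.
    by rewrite invr1 scale1r.
have DtC a : Dt (a%:MP)%:P = 0.
  by rewrite /Dt derivC map_polyC /= vfieldC subr0.
have Dtarc i j : (j < N)%N -> (Dt (arc N i))`_j = 0.
  move=> jN; rewrite coefDt !coef_poly !ltnS jN ltnW // iterS vfieldZ.
  rewrite -scaler_nat scalerA factS natrM invfM mulrA divff ?char0 // mul1r.
  by rewrite subrr.
have Dq j : (j < N)%N -> q`_j.+1 *+ j.+1 = vfield w q`_j.
  move=> jN; apply/eqP; rewrite -subr_eq0 -coefDt.
  rewrite (derivation_mmap (c := @polyC _ \o @mpolyC n K) _ _ Dt_derivation DtC).
  rewrite coef_sum big1 // => k _; rewrite coefM big1 // => i _.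
  by rewrite Dtarc ?mulr0 // (leq_ltn_trans (leq_subr _ _)).
elim=> [|k IH] kN; first by rewrite q0.
move=> u Xu; have := tangent_w (IH (ltnW kN)) Xu.
rewrite -Dq // mevalMn -mulr_natl => /eqP.
by rewrite mulf_eq0 (negPf (char0 k)) => /eqP.
Qed.

(* Chords issued from x through nearby points of X, rescaled by 1/t, give the
   curve x' + t/2 x'' + t^2/6 x''' + ...  The coefficient of t^2 in G along it
   and the second derivative of G x' = 0 differ by the required identity. *)
Lemma chord_identity d (G : {mpoly K[n]}) : G \is d.-homog ->
  (forall u v, X u -> X v -> G.@[fun i => v 0 i - u 0 i] = 0) ->
  forall u, X u ->
  \sum_(k < n) G^`M(k).@[fun i => (w i).@[u 0]] *
               (vfield w (vfield w (w k))).@[u 0] = 0.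
Proof.
move=> Gd Gchord.
(* [eta] is the chord (x(t) - x)/t. Homogeneity turns G(x(t) - x) into t^d G(eta), so following the
   curve up to order d + 3 reaches the coefficients 0 to 3 of G(eta). *)
pose eta (u : 'rV[K]_n) (i : 'I_n) : {poly K} :=
  \poly_(j < d + 3) ((j.+1`!%:R)^-1 * (iter j (vfield w) (w i)).@[u 0]).
have Geta (u : 'rV[K]_n) : X u -> forall k, (k < 4)%N -> (mmap (@polyC K) (eta u) G)`_k = 0.
  move=> Xu k k4.
  (* The base point [u] is frozen in [F]; evaluating at the same [u] after following the curve gives
     the chord issued from [u]. *)
  pose F := mmap (@mpolyC n K) (fun i => 'X_i - (u 0 i)%:MP) G.
  have F0 : vanish X F.
    move=> v Xv; rewrite -(Gchord _ _ Xu Xv).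
    apply: (rmorph_mmap (psi := meval (v 0)) (c' := idfun)) => [a|i] /=.
      by rewrite mevalC.
    by rewrite mevalB mevalXU mevalC.
  have kN : (d + k <= d + 3)%N by rewrite leq_add2l -ltnS.
  have := arc_vanish F0 kN Xu.
  rewrite -[_.@[_]](coef_map_id0 (f := meval (u 0))) ?meval0 //.
  rewrite -[map_poly _ _]/(map_poly (meval (u 0)) _).
  have -> : map_poly (meval (u 0))
      (mmap (@polyC _ \o @mpolyC n K) (arc (d + 3)) F) = 'X^d * mmap (@polyC K) (eta u) G.
    rewrite -(mmap_homog _ _ 'X Gd).
    pose psi := map_poly (meval (u 0)) \o mmap (@polyC _ \o @mpolyC n K) (arc (d + 3)).
    apply: (rmorph_mmap (psi := psi)) => [a|i] /=.
      by rewrite mmapC /= map_polyC /= mevalC.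
    rewrite rmorphB rmorphB /= mmapX mmap1U mmapC /= map_polyC /= mevalC.
    apply/polyP => j; rewrite coefB coefXM coefC coef_map_id0 ?meval0 // !coef_poly.
    case: j => [|j]; first by rewrite fact0 invr1 scale1r /= mevalXU subrr.
    rewrite /= ltnS subr0; case: ifP => _; last by rewrite meval0.
    by rewrite mevalZ -iterS iterSr vfieldX.
  by rewrite coefXnM ltnNge leq_addr /= addKn.
have G0 (u : 'rV[K]_n) : X u -> G.@[fun i => (w i).@[u 0]] = 0.
  move=> Xu; rewrite -[RHS](Geta u Xu 0%N isT) -horner_coef0 -[RHS]/(horner_eval 0 _).
  apply/esym; apply: (rmorph_mmap (c' := idfun)) => [a|i]; rewrite /= /horner_eval ?hornerC //.
  by rewrite horner_coef0 coef_poly addnS /= factS fact0 muln1 invr1 mul1r.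
pose Gw (H : {mpoly K[n]}) := mmap (@mpolyC n K) w H.
have Gw_ev H (u : 'rV[K]_n) : (Gw H).@[u 0] = H.@[fun i => (w i).@[u 0]].
  by apply: (rmorph_mmap (psi := meval (u 0)) (c' := idfun)) => [a|i] //=; rewrite mevalC.
have I0 : vanish X (Gw G) by move=> u Xu; rewrite Gw_ev G0.
have I2 := tangent_w (tangent_w I0).
have vGw H : vfield w (Gw H) = \sum_k Gw H^`M(k) * vfield w (w k).
  by apply: derivation_mmap dw _ => a; exact: vfieldC.
move=> u Xu; set a := fun i => (w i).@[u 0].
pose b i := (vfield w (w i)).@[u 0].
pose c i := (vfield w (vfield w (w i))).@[u 0].
(* G(w) = 0 on [X], differentiated twice along [w]. *)
have E1 : \sum_k \sum_l G^`M(k)^`M(l).@[a] * b l * b k + \sum_k G^`M(k).@[a] * c k = 0.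
  rewrite -[RHS](I2 u Xu) vGw (drv_sum dw) (raddf_sum (meval (u 0))) -big_split /=.
  apply: eq_bigr => k _; rewrite (drvM dw) vGw mevalD !mevalM Gw_ev [RHS]addrC.
  congr (_ + _); rewrite -/(b k) (raddf_sum (meval (u 0))) mulr_sumr /=; apply: eq_bigr => l _.
  by rewrite mevalM Gw_ev -/(b l) mulrC.
pose Ge (H : {mpoly K[n]}) := mmap (@polyC K) (eta u) H.
have Ge0 H : (Ge H)`_0 = H.@[a].
  rewrite -horner_coef0 -[LHS]/(horner_eval 0 _).
  apply: (rmorph_mmap (c' := idfun)) => [x|i]; rewrite /= /horner_eval ?hornerC //.
  by rewrite horner_coef0 coef_poly addnS /= factS fact0 muln1 invr1 mul1r.
have dGe H : (Ge H)^`() = \sum_k Ge H^`M(k) * (eta u k)^`().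
  apply: derivation_mmap => [|x]; last by rewrite derivC.
  by split=> x y; [exact: derivD|rewrite derivM addrC [x^`() * _]mulrC].
(* The second derivative at t = 0 of G along [eta], whose first two derivatives there are b/2 and
   c/3. *)
have E2 : \sum_k \sum_l G^`M(k)^`M(l).@[a] * (b l / 2%:R) * (b k / 2%:R)
        + \sum_k G^`M(k).@[a] * (c k / 3%:R) = 0.
  have : (Ge G)^`()^`()`_0 = 0 by rewrite !coef_deriv (Geta u Xu 2) // !mul0rn.
  have e1 k : (eta u k)^`()`_0 = b k / 2%:R.
    by rewrite coef_deriv coef_poly addnS addnS /= mulr1n mulrC.
  have e2 k : (eta u k)^`()^`()`_0 = c k / 3%:R.
    rewrite !coef_deriv coef_poly !addnS /= mulr1n -/(c k) -mulr_natl.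
    have -> : 3`! = (3 * 2)%N by [].
    by rewrite natrM; field; rewrite !char0.
  rewrite dGe (raddf_sum (@deriv K)) coef_sum => e; rewrite -[RHS]e -big_split /=.
  apply: eq_bigr => k _; rewrite derivM coefD !coef0M Ge0 e1 e2 addrC [RHS]addrC.
  congr (_ + _); rewrite dGe coef_sum [RHS]mulr_suml; apply: eq_bigr => l _.
  by rewrite coef0M Ge0 e1.
pose S := \sum_k \sum_l G^`M(k)^`M(l).@[a] * (b l / 2%:R) * (b k / 2%:R).
pose T := \sum_k G^`M(k).@[a] * (c k / 3%:R).
have eS : \sum_k \sum_l G^`M(k)^`M(l).@[a] * b l * b k = 4%:R * S.
  rewrite [RHS]mulr_sumr; apply: eq_bigr => k _.
  rewrite [RHS]mulr_sumr; apply: eq_bigr => l _.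
  by field; exact: char0.
have eT : \sum_k G^`M(k).@[a] * c k = 3%:R * T.
  rewrite [RHS]mulr_sumr; apply: eq_bigr => k _.
  by field; exact: char0.
rewrite -/S -/T in E2.
suff T0 : T = 0 by rewrite -[LHS]/(\sum_k G^`M(k).@[a] * c k) eT T0 mulr0.
(* Relative to [E2], the Hessian term of [E1] is scaled by 4 but the gradient term by 3, so
   eliminating the Hessian leaves the gradient term alone. *)
transitivity (4%:R * (S + T) - (4%:R * S + 3%:R * T)); first by ring.
by rewrite -eS -eT E1 E2 mulr0 subrr.
Qed.
End Arc.
End VectorFields.

(** * Vanishing ideals *)

Lemma common_denominator (P : comNzRingType) (L : fieldType)
    (phi : {rmorphism P -> L}) (J : finType) (z : J -> L) :
  (forall y, exists p q, phi q <> 0 /\ y = phi p / phi q) ->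
  exists (q : P) (p : J -> P), phi q <> 0 /\ forall j, phi (p j) = phi q * z j.
Proof.
move=> frac; have /choice[a Ha] : forall j, exists pq : P * P,
    phi pq.2 <> 0 /\ z j = phi pq.1 / phi pq.2.
  by move=> j; have [p [q h]] := frac (z j); exists (p, q).
exists (\prod_j (a j).2), (fun j => (a j).1 * \prod_(i | i != j) (a i).2); split.
  rewrite rmorph_prod; apply/eqP/prodf_neq0 => j _; apply/eqP; exact: (Ha j).1.
move=> j; rewrite [in RHS](bigD1 j) //= !rmorphM /= (Ha j).2.
by field; apply/eqP; exact: (Ha j).1.
Qed.

Lemma kernel_sub_row (F : fieldType) (n1 k N : nat) (V : 'M[F]_(n1, N))
    (J : 'M[F]_(k, N)) : (k + n1 = N)%N -> row_free V -> row_free J ->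
  V *m J^T = 0 -> forall w : 'rV_N, w *m J^T = 0 -> (w <= V)%MS.
Proof.
move=> kn fV fJ VJ w wJ.
have VK : (V <= kermx J^T)%MS by apply/sub_kermxP.
have wK : (w <= kermx J^T)%MS by apply/sub_kermxP.
apply: submx_trans wK _; rewrite -(mxrank_leqif_sup VK).
by rewrite mxrank_ker mxrank_tr (eqP fJ) (eqP fV) -kn addKn.
Qed.

Section VanishingIdeal.
Variables (K : fieldType) (n : nat).
Implicit Types (X Y : set 'rV[K]_n) (F G : {mpoly K[n]}).

Definition prime_vanish X : Prop := X !=set0 /\
  forall F G, vanish X (F * G) -> vanish X F \/ vanish X G.

Lemma vanish0 X : vanish X 0. Proof. by move=> u _; rewrite meval0. Qed.

Lemma vanishD X F G : vanish X F -> vanish X G -> vanish X (F + G).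
Proof. by move=> hF hG u Xu; rewrite mevalD hF // hG // addr0. Qed.

Lemma vanishMl X F G : vanish X G -> vanish X (F * G).
Proof. by move=> hG u Xu; rewrite mevalM hG // mulr0. Qed.

Lemma vanish_natr X m : X !=set0 -> vanish X m%:R -> m%:R = 0 :> K.
Proof. by move=> [u Xu] /(_ _ Xu); rewrite rmorph_nat. Qed.

Lemma coordinate_field X : prime_vanish X ->
  exists (L : fieldType) (phi : {rmorphism {mpoly K[n]} -> L}),
    (forall F, phi F = 0 <-> vanish X F) /\
    (forall z, exists p q, phi q <> 0 /\ z = phi p / phi q).
Proof.
move=> [[u Xu] pX]; apply: function_field => //.
- exact: vanish0.
- by move=> /(_ _ Xu) /eqP; rewrite meval1 oner_eq0.
- by move=> a F G hF hG; apply: vanishD hG; exact: vanishMl.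
Qed.

Definition alg_independent X m (f : 'I_m -> {mpoly K[n]}) : Prop :=
  forall Q : {mpoly K[m]}, vanish X (mmap (@mpolyC n K) f Q) -> Q = 0.

Hypothesis char0 : forall m, (m.+1%:R : K) != 0.

(* The derivations d/df_i of K(f_0, ..., f_(m-1)) extend to the function field
   of X; V i is such an extension multiplied by the common denominator h. *)
Lemma independent_vfields X m (f : 'I_m -> {mpoly K[n]}) :
  prime_vanish X -> alg_independent X f ->
  exists (V : 'I_m -> 'I_n -> {mpoly K[n]}) (h : {mpoly K[n]}),
  [/\ ~ vanish X h,
      forall i F, vanish X F -> vanish X (vfield (V i) F) &
      forall i j, vanish X (vfield (V i) (f j) - (i == j)%:R * h)].
Proof.
move=> pX indf; have [L [phi [phi0 frac]]] := coordinate_field pX.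
have charL k : (k.+1%:R : L) != 0.
  apply/eqP; rewrite -(rmorph_nat phi) => /phi0 /(vanish_natr pX.1) /eqP.
  exact/negP/char0.
have /choice[D HD] : forall i : 'I_m, exists D : L -> L, [/\ derivation D,
    forall c, D (phi c%:MP) = 0 & forall j, D (phi (f j)) = (i == j)%:R].
  move=> i; pose ev (Q : {mpoly K[m]}) := phi (mmap (@mpolyC n K) f Q).
  (* The graph of Q(f) |-> (dQ/df_i)(f); independence of the f_j makes it single-valued. *)
  pose M : set (L * L) := fun a => exists Q, a = (ev Q, ev Q^`M(i)).
  have gM : dual_graph M.
    split.
    - by exists 1; rewrite /ev !rmorph1 -mpolyC1 mderivC mmap0 rmorph0.
    - move=> a b [Q ->] [Q' ->]; exists (Q - Q') => /=.
      by rewrite /ev mderivB !rmorphB.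
    - move=> a b [Q ->] [Q' ->]; exists (Q * Q') => /=.
      rewrite /ev mderivM !rmorphD /= !rmorphM /=; congr (_, _); ring.
    - move=> b [Q [/esym /phi0 /indf -> ->]].
      by rewrite /ev mderiv0 !rmorph0.
  have [E [dE EM]] := derivation_extension charL gM.
  exists E; split=> // [c|j].
    have /EM : M (phi c%:MP, 0); last by [].
    by exists c%:MP; rewrite /ev mderivC mmapC !rmorph0.
  have /EM : M (phi (f j), (i == j)%:R); last by [].
  exists 'X_j; rewrite /ev mmapX mmap1U mderivXU eq_sym; congr (_, _).
  by rewrite !rmorph_nat.
have [h [V' [h0 HV]]] := common_denominator (fun ik : 'I_m * 'I_n => D ik.1 (phi 'X_(ik.2))) frac.
exists (fun i k => V' (i, k)), h.
(* On [X] the new field acts as h D_i, hence it preserves the ideal of [X]. *)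
have VF i F : phi (vfield (fun k => V' (i, k)) F) = phi h * D i (phi F).
  have [dD DC _] := HD i.
  rewrite [in RHS](meval_mmap phi F) (derivation_mmap (c := phi \o @mpolyC n K) _ _ dD) //.
  rewrite rmorph_sum mulr_sumr; apply: eq_bigr => k _.
  by rewrite rmorphM HV -(meval_mmap phi) /=; ring.
split.
- by move/phi0.
- move=> i F /phi0 F0; apply/phi0; have [dD _ _] := HD i.
  by rewrite VF F0 (drv0 dD) mulr0.
- move=> i j; apply/phi0; rewrite rmorphB VF rmorphM rmorph_nat.
  by have [_ _ ->] := HD i; rewrite mulrC subrr.
Qed.

Section IndependentStep.
Variables (m : nat) (f : 'I_m -> {mpoly K[n]}) (g : {mpoly K[n]}).

Let f' (i : 'I_m.+1) := if unlift ord_max i is Some j then f j else g.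
Let X' (i : 'I_m.+1) : {poly {mpoly K[m]}} :=
  if unlift ord_max i is Some j then ('X_j)%:P else 'X.

(** Write a relation as a polynomial in [g] with coefficients in the f_j. On [Y], where [g]
    vanishes, only the constant coefficient survives, and it is zero by independence; then [g] is
    cancelled on [Y'] and the degree drops. An inclusion of ideals is assumed instead of one of sets
    because the vertex, used as the first [Y], is not a point of the cone [Y']. *)
Lemma alg_independent_step Y Y' :
  alg_independent Y f -> (forall F, vanish Y' F -> vanish Y F) ->
  prime_vanish Y' -> vanish Y g -> ~ vanish Y' g -> alg_independent Y' f'.
Proof.
move=> indf YY' pY' Yg Y'g Q.
pose uni (R : {mpoly K[m.+1]}) := mmap (@polyC _ \o @mpolyC m K) X' R.
pose ev : {poly {mpoly K[m]}} -> {mpoly K[n]} := horner_eval g \o map_poly (mmap (@mpolyC n K) f).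
have evuni R : mmap (@mpolyC n K) f' R = ev (uni R).
  apply/esym; apply: (rmorph_mmap (psi := ev)) => [a|i].
    by rewrite /ev /= map_polyC /= mmapC /horner_eval hornerC.
  rewrite /ev /f' /X'; case: unliftP => [j _|_] /=.
    by rewrite map_polyC /= mmapX mmap1U /horner_eval hornerC.
  by rewrite map_polyX /horner_eval hornerX.
have uni_inj R : uni R = 0 -> R = 0.
  pose psi : {poly {mpoly K[m]}} -> {mpoly K[m.+1]} := horner_eval 'X_ord_max \o
     map_poly (mmap (@mpolyC m.+1 K) (fun j => 'X_(lift ord_max j))).
  have psiuni : psi (uni R) = R.
    rewrite -[RHS]comp_mpoly_id; apply: (rmorph_mmap (psi := psi)) => [a|i].
      by rewrite /psi /= map_polyC /= mmapC /horner_eval hornerC.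
    rewrite /psi /X' tnth_mktuple; case: unliftP => [j ->|->] /=.
      by rewrite map_polyC /= mmapX mmap1U /horner_eval hornerC.
    by rewrite map_polyX /horner_eval hornerX.
  by move=> R0; rewrite -psiuni R0 /psi rmorph0.
suff ev_inj q : vanish Y' (ev q) -> q = 0.
  by rewrite evuni => /ev_inj /uni_inj.
elim/poly_ind: q => [//|p c IH].
rewrite /ev /= rmorphD rmorphM /= map_polyX map_polyC /horner_eval.
rewrite hornerD hornerMX hornerC => h.
have c0 : c = 0.
  apply: indf; move=> u Yu; have := YY' _ h u Yu.
  by rewrite mevalD mevalM Yg // mulr0 add0r.
have fc0 : mmap (@mpolyC n K) f c = 0 by rewrite c0 mmap0.
change (vanish Y' (ev p * g + mmap (@mpolyC n K) f c)) in h.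
rewrite fc0 addr0 in h; rewrite c0 polyC0 addr0; have [/IH ->|//] := proj2 pY' _ _ h.
by rewrite mul0r.
Qed.

End IndependentStep.
End VanishingIdeal.

(** * Cones *)

Local Notation hcomp d F := (pihomog [measure of mdeg] d F).

Section ProjectiveSets.
Variables (K : closedFieldType) (r : nat).
Hypothesis char0 : forall m, (m.+1%:R : K) != 0.
Implicit Types (X Y Z : set 'rV[K]_r.+1) (F G : {mpoly K[r.+1]}) (u v : 'rV[K]_r.+1).

Lemma meval_scale u t F : F.@[(t *: u) 0] = F.@[fun i => t * u 0 i].
Proof. by apply: meval_eq => i; rewrite mxE. Qed.

Lemma meval_scale_homog u t d F : F \is d.-homog ->
  F.@[(t *: u) 0] = t ^+ d * F.@[u 0].
Proof. by move=> Fd; rewrite meval_scale (meval_homog _ _ Fd). Qed.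

Definition cone X : Prop :=
  (forall u, X u -> u != 0) /\ forall u t, X u -> t != 0 -> X (t *: u).

Lemma zclosed_cone Z : zclosed Z -> cone Z.
Proof.
move=> [S [homS ->]]; split=> [u []//|u t [u0 Su] t0].
split=> [|F SF]; first by rewrite scaler_eq0 negb_or t0.
by have [d Fd] := homS F SF; rewrite (meval_scale_homog _ _ Fd) Su // mulr0.
Qed.

Lemma cone_setI X Z : cone X -> zclosed Z -> cone (X `&` Z).
Proof.
move=> [X0 Xs] /zclosed_cone[Z0 Zs]; split=> [u [/X0]//|u t [Xu Zu] t0].
by split; [exact: Xs|exact: Zs].
Qed.

Lemma quasi_projective_cone X : quasi_projective_variety X -> cone X.
Proof.
move=> [[Z1 [Z2 [/zclosed_cone[Z10 Z1s] /zclosed_cone[_ Z2s] ->]]] _].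
split=> [u [/Z10]//|u t [Z1u Z2u] t0]; split; first exact: Z1s.
move=> /(Z2s _ t^-1); rewrite scalerA mulVf // scale1r invr_eq0 => h.
exact/Z2u/h.
Qed.

(** For [F] inhomogeneous, the points whose whole line lies in the zero set of [F]. *)
Definition zlocus F : set 'rV[K]_r.+1 :=
  [set u : 'rV[K]_r.+1 | u != 0 /\ forall d, (hcomp d F).@[u 0] = 0].

Lemma zlocus_closed F : zclosed (zlocus F).
Proof.
exists [set G | exists d, G = hcomp d F]; split.
  by move=> _ [d ->]; exists d; exact: pihomogP.
apply/seteqP; split=> u [u0 h]; split=> //.
  by move=> _ [d ->].
by move=> d; apply: h; exists d.
Qed.

Lemma zlocus_meval F u : zlocus F u -> F.@[u 0] = 0.
Proof.
move=> [_ h]; rewrite [F in F.@[_]](pihomog_partitionE (mf := [measure of mdeg]) (leqnn _)).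
by rewrite (raddf_sum (meval (u 0))) big1 // => d _; exact: h.
Qed.

Lemma zlocus_homog d F u : F \is d.-homog -> u != 0 -> F.@[u 0] = 0 -> zlocus F u.
Proof.
move=> Fd u0 Fu; split=> // e; have [->|de] := eqVneq e d.
  by rewrite pihomog_dE.
by rewrite (pihomog_ne0 _ Fd) ?meval0 // eq_sym.
Qed.

Lemma not_zlocus F u : u != 0 -> ~ zlocus F u ->
  exists2 t, t != 0 & F.@[(t *: u) 0] != 0.
Proof.
move=> u0 nF; apply: contrapT => h; apply: nF; split=> //.
apply: meval_homog_comp => // t t0; apply/eqP; apply: contraT => Ft.
by case: h; exists t => //; rewrite meval_scale.
Qed.

(** Irreducibility speaks of homogeneous equations only. At a point of [X] outside both loci, F and
    G restrict to nonzero polynomials on the line through it, so FG is nonzero at some nonzero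
    multiple of that point. *)
Lemma zirreducible_prime X : cone X -> zirreducible X -> prime_vanish X.
Proof.
move=> [X0 Xs] [Xn irrX]; split=> // F G FG0.
have [|h|h] := irrX _ _ (zlocus_closed F) (zlocus_closed G); last 2 first.
- by left=> u /h /zlocus_meval.
- by right=> u /h /zlocus_meval.
move=> u Xu; apply: contrapT => /not_orP[nF nG].
have line H : ~ zlocus H u -> exists2 p : {poly K}, p <> 0 &
    forall t, p.[t] = H.@[(t *: u) 0].
  move=> /(not_zlocus (X0 _ Xu))[t t0 Ht].
  have [p Hp] := meval_line (fun=> 0) (u 0) H.
  have Hp' s : p.[s] = H.@[(s *: u) 0].
    by rewrite Hp meval_scale; apply: meval_eq => i; rewrite add0r.
  by exists p => // p0; move: Ht; rewrite -Hp' p0 horner0 eqxx.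
have [[p /eqP p0 Hp] [q /eqP q0 Hq]] := (line _ nF, line _ nG).
have /eqP/(poly_neq0_val char0)[t t0] : p * q != 0 by rewrite mulf_neq0.
by rewrite hornerM Hp Hq -mevalM FG0 ?eqxx //; exact: Xs.
Qed.

Lemma has_dim_uniq X m n : has_dim X m -> has_dim X n -> m = n.
Proof.
move=> [cm bm] [cn bn]; apply/eqP; rewrite eqn_leq.
by rewrite (bn _ cm) (bm _ cn).
Qed.

(* The chain is completed below by the vertex of the cone, whose vanishing
   ideal is the irrelevant ideal; hence n + 1 independent functions. *)
Lemma chain_independent X n : cone X ->
  (exists C : nat -> set 'rV[K]_r.+1, irreducible_chain X n C) ->
  exists f : 'I_n.+1 -> {mpoly K[r.+1]}, alg_independent X f.
Proof.
move=> coneX [Y [irrY incY]].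
have coneY i : (i <= n)%N -> cone (Y i).
  by move=> /irrY[_ [Z Zc ->]]; exact: cone_setI.
have primeY i : (i <= n)%N -> prime_vanish (Y i).
  by move=> ni; apply: zirreducible_prime (coneY _ ni) (irrY _ ni).1.
suff H i : (i <= n)%N ->
    exists f : 'I_i.+1 -> {mpoly K[r.+1]}, alg_independent (Y i) f.
  have [f Hf] := H n (leqnn n); exists f => Q XQ; apply: Hf => u Yu.
  by apply: XQ; have [_ [Z _ YZ]] := irrY n (leqnn n); move: Yu; rewrite YZ => -[].
elim: i => [|i IH] ni.
  have [[u Yu] _] := primeY _ ni; have u0 := (coneY _ ni).1 _ Yu.
  have /existsP[j uj] : [exists j, u 0 j != 0].
    apply: contraT => /existsPn h; case/negP: u0; apply/eqP/rowP => j.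
    by rewrite mxE; apply/eqP; have := h j; rewrite negbK.
  pose f0 (k : 'I_0) : {mpoly K[r.+1]} := 0.
  have ind0 : alg_independent [set 0] f0.
    move=> Q /(_ 0 erefl); rewrite (nvar0_mpolyC Q) mmapC mevalC => ->.
    by rewrite mpolyC0.
  eexists; apply: (alg_independent_step (g := 'X_j) ind0 _ (primeY _ ni)).
  - move=> F YF _ ->; have [p Hp] := meval_line (fun=> 0) (u 0) F.
    have p0 : 'X * p = 0.
      apply: (poly_eq0_char0 char0) => t; rewrite hornerM hornerX Hp.
      have [->|t0] := eqVneq t 0; first by rewrite mul0r.
      suff -> : F.@[fun i => 0 + t * u 0 i] = 0 by rewrite mulr0.
      rewrite -[RHS](YF _ ((coneY _ ni).2 _ _ Yu t0)).
      by apply: meval_eq => k; rewrite mxE /= add0r.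
    move/eqP: p0; rewrite mulf_eq0 polyX_eq0 => /eqP p0.
    have := Hp 0; rewrite p0 horner0 => ->; apply: meval_eq => k.
    by rewrite mxE /= mul0r addr0.
  - by move=> _ ->; rewrite mevalXU mxE.
  - by move=> /(_ _ Yu) /eqP; rewrite mevalXU; exact/negP.
have [f indf] := IH (ltnW ni); have [subY neqY] := incY _ ni.
have [_ [Z Zc YZ]] := irrY _ (ltnW ni).
have [u [Yu nYu]] : exists u, Y i.+1 u /\ ~ Y i u.
  apply: contrapT => h; apply: neqY; apply/seteqP; split=> // u Yu.
  by apply: contrapT => nYu; apply: h; exists u.
have Xu : X u by have [_ [Z' _ YZ']] := irrY _ ni; move: Yu; rewrite YZ' => -[].
have [S [homS ZS]] := Zc.
have [F [SF Fu]] : exists F, S F /\ F.@[u 0] <> 0.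
  apply: contrapT => h; apply: nYu; rewrite YZ; split=> //; rewrite ZS; split.
    exact: coneX.1.
  by move=> F SF; apply: contrapT => Fu; apply: h; exists F.
eexists; apply: (alg_independent_step (g := F) indf _ (primeY _ ni)).
- by move=> G YG v Yv; apply: YG; exact: subY.
- by move=> v; rewrite YZ ZS => -[_ [_ +]]; apply.
- by move=> /(_ _ Yu).
Qed.

End ProjectiveSets.

(** * Tangent spaces *)

Section TangentSpaces.
Variables (K : closedFieldType) (r : nat).
Implicit Types (F G : {mpoly K[r.+1]}) (u v x : 'rV[K]_r.+1).

Definition jacobian k (F : 'I_k -> {mpoly K[r.+1]}) : 'M[{mpoly K[r.+1]}]_(k, r.+1) :=
  \matrix_(i, j) (F i)^`M(j).

Definition mx_at m p (A : 'M[{mpoly K[r.+1]}]_(m, p)) u : 'M[K]_(m, p) :=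
  map_mx (meval (u 0)) A.

Definition vfield_mx m (V : 'I_m -> 'I_r.+1 -> {mpoly K[r.+1]}) :=
  (\matrix_(i, j) V i j : 'M[{mpoly K[r.+1]}]_(m, r.+1)).

Lemma jacobian_at_mul k (F : 'I_k -> {mpoly K[r.+1]}) u v i :
  (v *m (mx_at (jacobian F) u)^T) 0 i = \sum_(j < r.+1) (F i)^`M(j).@[u 0] * v 0 j.
Proof. by rewrite mxE; apply: eq_bigr => j _; rewrite !mxE mulrC. Qed.

Variables (X : set 'rV[K]_r.+1) (n : nat).
Hypotheses (coneX : cone X) (primeX : prime_vanish X) (dimX : has_dim X n).

Lemma proj_tangent_jacobian k (F : 'I_k -> {mpoly K[r.+1]}) x v :
  (forall i, vanish X (F i) /\ exists d, F i \is d.-homog) ->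
  proj_tangent X x v -> v *m (mx_at (jacobian F) x)^T = 0.
Proof.
move=> hF Tv; apply/rowP => i; rewrite jacobian_at_mul mxE.
by have [XF [d Fd]] := hF i; exact: Tv Fd XF.
Qed.

(** A homogeneous family whose gradients at x have the largest rank spans all gradients, so the
    kernel of its Jacobian is the tangent cone. Nonsingularity gives this kernel dimension n + 1,
    and independent rows are then selected. *)
Lemma nonsingular_jacobian x : nonsingular X x ->
  exists k (F : 'I_k -> {mpoly K[r.+1]}), [/\ (k + n.+1 = r.+1)%N,
    forall i, vanish X (F i) /\ (exists d, F i \is d.-homog) &
    row_free (mx_at (jacobian F) x)].
Proof.
move=> [Xx [n' [dimX' [M [freeM TM]]]]].
have nn' : n' = n by exact: has_dim_uniq dimX' dimX.
subst n'.
pose eqn k (F : 'I_k -> {mpoly K[r.+1]}) := forall i, vanish X (F i) /\ exists d, F i \is d.-homog.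
pose P m := `[<exists k (F : 'I_k -> {mpoly K[r.+1]}), eqn k F /\
                 \rank (mx_at (jacobian F) x) = m>].
have exP : exists m, P m.
  pose F0 (i : 'I_0) : {mpoly K[r.+1]} := 0.
  by exists (\rank (mx_at (jacobian F0) x)); apply/asboolP; exists 0%N, F0; split=> // -[].
have bP m : P m -> (m <= r.+1)%N.
  by move=> /asboolP[k [F [_ <-]]]; exact: rank_leq_col.
case: (ex_maxnP exP bP) => m /asboolP[k [F [eF rF]]] maxm.
have gradJ G : vanish X G -> (exists d, G \is d.-homog) ->
    (\row_j G^`M(j).@[x 0] <= mx_at (jacobian F) x)%MS.
  move=> XG Gd; set g := \row_j _; apply: contraT => ngJ.
  pose F' (i : 'I_(k + 1)) := match split i with inl j => F j | inr _ => G end.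
  have eF' : eqn _ F' by move=> i; rewrite /F'; case: (split i) => // j; exact: eF.
  have eJ : mx_at (jacobian F') x = col_mx (mx_at (jacobian F) x) g.
    by apply/matrixP => i j; rewrite !mxE /F'; case: (split i) => a; rewrite !mxE.
  have : P (\rank (mx_at (jacobian F') x)) by apply/asboolP; exists (k + 1)%N, F'.
  move=> /maxm; rewrite leqNgt -rF eJ -addsmxE => /negP; case.
  apply: rank_ltmx; rewrite ltmxE addsmxSl /=.
  by apply: contra ngJ; apply: submx_trans; rewrite addsmxSr.
have kerT v : proj_tangent X x v <-> v *m (mx_at (jacobian F) x)^T = 0.
  split; first exact: proj_tangent_jacobian.
  move=> Jv d G Gd XG.
  have /submxP[a ea] := gradJ G XG (ex_intro _ d Gd).
  transitivity ((v *m (\row_j G^`M(j).@[x 0])^T) 0 0).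
    by rewrite mxE; apply: eq_bigr => j _; rewrite !mxE mulrC.
  by rewrite ea trmx_mul mulmxA Jv mul0mx mxE.
have eM : (M :=: kermx (mx_at (jacobian F) x)^T)%MS.
  apply/eqmxP/andP; split; apply/row_subP => i.
    by apply/sub_kermxP/kerT/TM; exact: row_sub.
  by apply/TM/kerT/sub_kermxP; exact: row_sub.
have dims : (m + n.+1 = r.+1)%N.
  rewrite -(eqP freeM) eM mxrank_ker mxrank_tr rF.
  by rewrite subnKC // bP //; apply/asboolP; exists k, F.
pose F' := F \o maxrankfun (mx_at (jacobian F) x).
exists _, F'; split; first by rewrite rF.
  by move=> i; exact: eF.
suff -> : mx_at (jacobian F') x = rowsub (maxrankfun (mx_at (jacobian F) x)) (mx_at (jacobian F) x).
  exact: maxrowsub_free.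
by apply/matrixP => i j; rewrite !mxE.
Qed.

Variables (V : 'I_n.+1 -> 'I_r.+1 -> {mpoly K[r.+1]}) (h : {mpoly K[r.+1]}).
Variable f : 'I_n.+1 -> {mpoly K[r.+1]}.
Hypothesis h_nz : ~ vanish X h.
Hypothesis tangent_V : forall i F, vanish X F -> vanish X (vfield (V i) F).
Hypothesis V_f : forall i j, vanish X (vfield (V i) (f j) - (i == j)%:R * h).

Local Notation V_at := (mx_at (vfield_mx V)).

(** Since V_i(f_j) = h delta_ij on [X], the gradients of the f_j divided by h form a right
    inverse. *)
Lemma V_row_free u : X u -> h.@[u 0] != 0 -> row_free (V_at u).
Proof.
move=> Xu hu; apply/row_freeP.
exists (\matrix_(k, j) ((f j)^`M(k).@[u 0] / h.@[u 0])).
apply/matrixP => i j; rewrite !mxE.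
have /eqP := V_f i j Xu; rewrite mevalB mevalM rmorph_nat subr_eq0 => /eqP e.
transitivity ((vfield (V i) (f j)).@[u 0] / h.@[u 0]); last first.
  by rewrite e mulfK.
rewrite /vfield (raddf_sum (meval (u 0))) [RHS]mulr_suml; apply: eq_bigr => k _.
by rewrite !mxE /= mevalM mulrA.
Qed.

Lemma V_jacobian k (F : 'I_k -> {mpoly K[r.+1]}) u : X u ->
  (forall i, vanish X (F i)) -> V_at u *m (mx_at (jacobian F) u)^T = 0.
Proof.
move=> Xu XF; apply/matrixP => i j; rewrite !mxE.
rewrite -[RHS](tangent_V i (XF j) Xu) /vfield (raddf_sum (meval (u 0))).
by apply: eq_bigr => l _; rewrite !mxE /= mevalM.
Qed.

Lemma V_tangent u : X u -> forall s : 'rV_n.+1, proj_tangent X u (s *m V_at u).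
Proof.
move=> Xu s d F Fd XF; pose F1 (i : 'I_1) := F.
have := V_jacobian Xu (fun i : 'I_1 => XF : vanish X (F1 i)).
move=> /(congr1 (fun A => (s *m A) 0 0)); rewrite mulmx0 mulmxA [RHS]mxE.
by rewrite jacobian_at_mul.
Qed.

Lemma tangent_span k (F : 'I_k -> {mpoly K[r.+1]}) u v :
  X u -> h.@[u 0] != 0 -> (k + n.+1 = r.+1)%N -> (forall i, vanish X (F i)) ->
  row_free (mx_at (jacobian F) u) -> v *m (mx_at (jacobian F) u)^T = 0 ->
  (v <= V_at u)%MS.
Proof.
move=> Xu hu kn XF fJ Jv; apply: kernel_sub_row kn _ fJ _ _ Jv.
  exact: V_row_free.
exact: V_jacobian.
Qed.

Lemma nonsingular_span x v : nonsingular X x -> h.@[x 0] != 0 ->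
  proj_tangent X x v -> (v <= V_at x)%MS.
Proof.
move=> nsx hx Tv; have [k [F [kn eF fJ]]] := nonsingular_jacobian nsx.
have Xx : X x by case: nsx.
apply: tangent_span kn _ fJ _ => //; first by move=> i; case: (eF i).
exact: proj_tangent_jacobian.
Qed.

(* The vector field w = det(JC) v0 - C adj(JC) J v0, where J(x) C = 1, is
   tangent to X and extends a given tangent vector v0 at x. *)
Lemma nonsingular_in_closure d G : G \is d.-homog ->
  (forall u (s : 'rV_n.+1), X u -> G.@[(s *m V_at u) 0] = 0) ->
  forall x v, nonsingular X x -> proj_tangent X x v -> G.@[v 0] = 0.
Proof.
move=> Gd GV x v nsx Tv; have [k [F [kn eF /row_freeP[C JC]]]] := nonsingular_jacobian nsx.
have Xx : X x by case: nsx.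
pose J := jacobian F; pose PC := map_mx (@mpolyC r.+1 K) C.
pose B := J *m PC; pose v0 := map_mx (@mpolyC r.+1 K) v^T.
pose w := \det B *: v0 - PC *m (\adj B *m (J *m v0)).
have Jw : J *m w = 0.
  rewrite mulmxBr -scalemxAr !mulmxA -/B mul_mx_adj -mulmxA mul_scalar_mx.
  by rewrite subrr.
have at_const m p (A : 'M[K]_(m, p)) u : mx_at (map_mx (@mpolyC r.+1 K) A) u = A.
  by apply/matrixP => i j; rewrite !mxE /= mevalC.
have detB u : (\det B).@[u 0] = \det (mx_at J u *m C).
  by rewrite -det_map_mx map_mxM -/(mx_at _ _) -/(mx_at _ _) at_const.
pose Gw := mmap (@mpolyC r.+1 K) (fun i => w i 0) G.
have Gw_at u : Gw.@[u 0] = G.@[fun i => (mx_at w u) i 0].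
  apply: (rmorph_mmap (psi := meval (u 0)) (c' := idfun)) => [a|i] /=.
    by rewrite mevalC.
  by rewrite [RHS]mxE.
have XGw : vanish X Gw.
  (* The factor h det(B) vanishes wherever the V_i or the Jacobian may degenerate. Primality removes
     it afterwards, and at [x], where JC = 1, the field w takes the value v. *)
  have : vanish X (h * (\det B * Gw)).
    move=> u Xu; rewrite !mevalM detB; have [->|hu] := eqVneq h.@[u 0] 0.
      by rewrite mul0r.
    have [->|Bu] := eqVneq (\det (mx_at J u *m C)) 0; first by rewrite mul0r mulr0.
    suff -> : Gw.@[u 0] = 0 by rewrite !mulr0.
    rewrite Gw_at; have /submxP[s es] : ((mx_at w u)^T <= V_at u)%MS.
      apply: (tangent_span (F := F)) => //; first by move=> i; case: (eF i).
        have /row_freeP[D hD] : row_free (mx_at J u *m C).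
          by rewrite row_free_unit unitmxE unitfE.
        by apply/row_freeP; exists (C *m D); rewrite mulmxA.
      by rewrite -trmx_mul -map_mxM Jw map_mx0 trmx0.
    rewrite -[RHS](GV u s Xu) -es; apply: meval_eq => i; by rewrite [RHS]mxE.
  move=> /(proj2 primeX)[//|/(proj2 primeX)[XB|//]].
  by have := XB x Xx; rewrite detB JC det1 => /eqP; rewrite oner_eq0.
have := XGw x Xx; rewrite Gw_at => <-; apply: meval_eq => i.
have Jv : mx_at J x *m v^T = 0.
  by rewrite -[LHS]trmxK trmx_mul trmxK (proj_tangent_jacobian eF Tv) trmx0.
rewrite /mx_at /w map_mxB map_mxZ !map_mxM -/(mx_at _ _) -/(mx_at _ _) -/(mx_at _ _) -/(mx_at _ _).
rewrite !at_const Jv !mulmx0 subr0 /= detB JC det1 scale1r.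
by rewrite mxE.
Qed.

(** At points of [X] off the zeros of h det(JC), the Jacobian has full rank and the V_i are
    independent, so they span the tangent space. Primality finds such a point where [F] is nonzero
    too. *)
Lemma generic_nonsingular F : (exists x, nonsingular X x) -> ~ vanish X F ->
  exists2 x, nonsingular X x & h.@[x 0] * F.@[x 0] != 0.
Proof.
move=> [x1 ns1] XF; have [k [E [kn eE /row_freeP[C JC]]]] := nonsingular_jacobian ns1.
have Xx1 : X x1 by case: ns1.
pose J := jacobian E; pose PC := map_mx (@mpolyC r.+1 K) C.
have detB u : (\det (J *m PC)).@[u 0] = \det (mx_at J u *m C).
  rewrite -det_map_mx map_mxM; congr (\det (_ *m _)).
  by apply/matrixP => i j; rewrite !mxE /= mevalC.
have XB : ~ vanish X (\det (J *m PC)).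
  by move=> /(_ x1 Xx1); rewrite detB JC det1 => /eqP; rewrite oner_eq0.
have : ~ vanish X (h * F * \det (J *m PC)).
  by move=> /(proj2 primeX)[/(proj2 primeX)[]|].
move=> nX; have [u [Xu nu]] : exists u, X u /\ (h * F * \det (J *m PC)).@[u 0] != 0.
  apply: contrapT => H; apply: nX => u Xu; apply/eqP; apply: contraT => nu.
  by case: H; exists u.
move: nu; rewrite !mevalM mulf_eq0 negb_or detB => /andP[hF Bu].
have hu : h.@[u 0] != 0 by move: hF; rewrite mulf_eq0 negb_or => /andP[].
exists u => //; split=> //; exists n; split=> //; exists (V_at u); split.
  exact: V_row_free.
move=> v; split=> [Tv|/submxP[s ->]]; last exact: V_tangent.
apply: (tangent_span (F := E)) => //; first by move=> i; case: (eE i).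
  have /row_freeP[D hD] : row_free (mx_at J u *m C).
    by rewrite row_free_unit unitmxE unitfE.
  by apply/row_freeP; exists (C *m D); rewrite mulmxA.
exact: proj_tangent_jacobian.
Qed.

Hypothesis n_gt0 : (1 <= n)%N.

(** Were all of [X] proportional to [u], the first two sets of the chain would be the same line.
    This provides a proper chord at every point. *)
Lemma not_proportional u : X u -> exists2 y, X y & forall c : K, y <> c *: u.
Proof.
move=> Xu; have [[Y [irrY incY]] _] := dimX.
have [_ [Z Zc YZ]] := irrY 0%N (leq0n _).
have [[[p0 Y0p] _] _] := irrY 0%N (leq0n _).
have [_ [Z1 _ Y1Z]] := irrY 1%N n_gt0.
have [sub01 neq01] := incY 0%N n_gt0.
have [p1 [Y1p nYp]] : exists p, Y 1%N p /\ ~ Y 0%N p.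
  apply: contrapT => H; apply: neq01; apply/seteqP; split=> // p Yp.
  by apply: contrapT => nYp; apply: H; exists p.
have Xp0 : X p0 by move: Y0p; rewrite YZ => -[].
have Xp1 : X p1 by move: Y1p; rewrite Y1Z => -[].
apply: contrapT => H.
have mult y : X y -> exists c, y = c *: u.
  move=> Xy; apply: contrapT => ny; apply: H; exists y => // c yc.
  by apply: ny; exists c.
have [[a ea] [b eb]] := (mult _ Xp0, mult _ Xp1).
have a0 : a != 0.
  by apply: contraTneq (coneX.1 _ Xp0) => a0; rewrite ea a0 scale0r eqxx.
have b0 : b != 0.
  by apply: contraTneq (coneX.1 _ Xp1) => b0; rewrite eb b0 scale0r eqxx.
apply: nYp; have -> : p1 = (b / a) *: p0 by rewrite ea scalerA divfK.
move: Y0p; rewrite YZ => Yp; apply: ((cone_setI coneX Zc).2 _ _ Yp).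
by rewrite mulf_neq0 // invr_eq0.
Qed.

Hypothesis tau_sec : tangent_variety X = secant_variety X.

(** Without a nonsingular point tau(X) would be empty, being contained in the empty closed set
    [zlocus 1], whereas Sec(X) contains a point of [X]. *)
Lemma exists_nonsingular : exists x, nonsingular X x.
Proof.
apply: contrapT => nns; have [[u Xu] _] := primeX.
have [y Xy yu] := not_proportional Xu.
have : secant_variety X y.
  move=> Z _; apply; split; first exact: coneX.1.
  by exists u, y; split=> //; exists 0, 1; rewrite scale0r scale1r add0r.
rewrite -tau_sec => /(_ _ (@zlocus_closed _ _ 1)).
have sub : [set v | v != 0 /\ exists2 x, nonsingular X x & proj_tangent X x v] `<=` zlocus 1.
  by move=> v [_ [x nsx _]]; case: nns; exists x.
by move=> /(_ sub) /zlocus_meval /eqP; rewrite meval1 oner_eq0.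
Qed.

(** The chord v - u lies on Sec(X) = tau(X), where [G] vanishes by [nonsingular_in_closure].
    Proportional u and v span no line; primality settles that case. *)
Lemma chord_vanish d G : G \is d.-homog ->
  (forall u (s : 'rV_n.+1), X u -> G.@[(s *m V_at u) 0] = 0) ->
  forall u v, X u -> X v -> G.@[fun i => v 0 i - u 0 i] = 0.
Proof.
move=> Gd GV u v Xu.
have GT := nonsingular_in_closure Gd GV.
have chord y : X y -> (forall c : K, y <> c *: u) -> G.@[fun i => y 0 i - u 0 i] = 0.
  move=> Xy yu; have yu0 : y - u != 0.
    by rewrite subr_eq0; apply/eqP => e; apply: (yu 1); rewrite scale1r.
  have : secant_variety X (y - u).
    move=> Z _; apply; split=> //; exists u, y; split=> //.
    by exists (-1), 1; rewrite scaleN1r scale1r addrC.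
  rewrite -tau_sec => /(_ _ (@zlocus_closed _ _ G)).
  have sub : [set v | v != 0 /\ exists2 x, nonsingular X x & proj_tangent X x v] `<=` zlocus G.
    move=> w [w0 [x nsx Tw]]; apply: zlocus_homog Gd w0 _; exact: GT nsx Tw.
  move=> /(_ sub) /zlocus_meval e; rewrite -[RHS]e; apply: meval_eq => i.
  by rewrite !mxE.
have [y Xy yu] := not_proportional Xu.
(* The minors vanish together exactly at the multiples of [u]. One that is not identically zero on
   [X] serves as a factor that absorbs the points spanning no line with [u]. *)
pose q i j : {mpoly K[r.+1]} := (u 0 i)%:MP * 'X_j - (u 0 j)%:MP * 'X_i.
have [i [j Xq]] : exists i j, ~ vanish X (q i j).
  apply: contrapT => H.
  have /existsP[i ui] : [exists i, u 0 i != 0].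
    apply: contraT => /existsPn h0; case/negP: (coneX.1 _ Xu); apply/eqP/rowP => j.
    by rewrite mxE; apply/eqP; have := h0 j; rewrite negbK.
  apply: (yu (y 0 i / u 0 i)); apply/rowP => j; rewrite mxE.
  have /(_ y Xy) : vanish X (q i j).
    by apply: contrapT => nq; apply: H; exists i, j.
  rewrite mevalB !mevalM !mevalC !mevalXU => /eqP; rewrite subr_eq0 => /eqP e.
  by rewrite mulrAC [y 0 i * _]mulrC -e mulrC mulrA mulVf // mul1r.
pose Gu := mmap (@mpolyC r.+1 K) (fun i => 'X_i - (u 0 i)%:MP) G.
have Gu_at z : Gu.@[z 0] = G.@[fun i => z 0 i - u 0 i].
  apply: (rmorph_mmap (psi := meval (z 0)) (c' := idfun)) => [a|k] /=; first by rewrite mevalC.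
  by rewrite mevalB mevalXU mevalC.
have : vanish X (q i j * Gu).
  move=> z Xz; rewrite mevalM Gu_at.
  have [[c zc]|nzc] := pselect (exists c, z = c *: u).
    rewrite mevalB !mevalM !mevalC !mevalXU zc !mxE.
    by rewrite (_ : _ - _ = 0) ?mul0r //; ring.
  by rewrite chord ?mulr0 // => c zc; apply: nzc; exists c.
by move=> /(proj2 primeX)[//|XGu] Xv; rewrite -Gu_at XGu.
Qed.

End TangentSpaces.

(** * The tangent bundle *)

Section TangentBundle.
Variables (K : closedFieldType) (r n : nat).
Hypothesis char0 : forall m, (m.+1%:R : K) != 0.
Variable X : set 'rV[K]_r.+1.
Implicit Types (F G Q : {mpoly K[r.+1]}) (u v x : 'rV[K]_r.+1) (s : 'rV[K]_n.+1).
Implicit Types p q : {mpoly {mpoly K[r.+1]}[n.+1]}.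

(* Polynomial functions on X * K^(n+1), the second factor parametrizing the
   tangent vectors \sum_j s_j V_j. *)
Definition meval_bundle u s : {mpoly {mpoly K[r.+1]}[n.+1]} -> K :=
  mmap (meval (u 0)) (s 0).

HB.instance Definition _ u s := GRing.RMorphism.on (meval_bundle u s).

Definition vanish_bundle p : Prop := forall u s, X u -> meval_bundle u s p = 0.

Lemma meval_bundleC u s F : meval_bundle u s F%:MP = F.@[u 0].
Proof. exact: mmapC. Qed.

Lemma meval_bundleX u s j : meval_bundle u s 'X_j = s 0 j.
Proof. by rewrite /meval_bundle mmapX mmap1U. Qed.

Definition bundle_line u s s' : {mpoly {mpoly K[r.+1]}[n.+1]} -> {poly K} :=
  mmap (@polyC K \o meval (u 0)) (fun j => (s 0 j)%:P + (s' 0 j)%:P * 'X).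

Lemma bundle_lineE u s s' p t :
  (bundle_line u s s' p).[t] = meval_bundle u (s + t *: s') p.
Proof.
rewrite -[LHS]/(horner_eval t _).
apply: (rmorph_mmap (psi := horner_eval t)) => [F|j]; rewrite /= /horner_eval.
  by rewrite hornerC.
by rewrite hornerD hornerM !hornerC hornerX !mxE mulrC.
Qed.

Definition bundle_slice s : {mpoly {mpoly K[r.+1]}[n.+1]} -> {mpoly K[r.+1]} :=
  mmap idfun (fun j => (s 0 j)%:MP).

HB.instance Definition _ s := GRing.RMorphism.on (bundle_slice s).

Lemma bundle_sliceE u s p : (bundle_slice s p).@[u 0] = meval_bundle u s p.
Proof. by apply: (rmorph_mmap (psi := meval (u 0))) => [F|j] //=; rewrite mevalC. Qed.

(** Witnesses for p and q have different fibre coordinates s1 and s2. Some s on the line joining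
    these keeps both p and q nonzero at their base points, and primality for [X] applies to the
    slices at s. *)
Lemma bundle_prime p q : prime_vanish X -> vanish_bundle (p * q) ->
  vanish_bundle p \/ vanish_bundle q.
Proof.
move=> [_ pX] pq0; apply: contrapT => /not_orP[np nq].
have witness g : ~ vanish_bundle g -> exists u s, X u /\ meval_bundle u s g <> 0.
  move=> ng; apply: contrapT => H; apply: ng => u s Xu.
  by apply: contrapT => gu; apply: H; exists u, s.
have [[u1 [s1 [Xu1 pu]]] [u2 [s2 [Xu2 qu]]]] := (witness _ np, witness _ nq).
pose lp := bundle_line u1 s1 (s2 - s1) p; pose lq := bundle_line u2 s1 (s2 - s1) q.
have lp0 : lp != 0.
  apply/eqP => e; apply: pu; have := bundle_lineE u1 s1 (s2 - s1) p 0.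
  by rewrite -/lp e horner0 scale0r addr0.
have lq0 : lq != 0.
  apply/eqP => e; apply: qu; have := bundle_lineE u2 s1 (s2 - s1) q 1.
  by rewrite -/lq e horner0 scale1r addrC subrK.
have /eqP/(poly_neq0_val char0)[t _] : lp * lq != 0 by rewrite mulf_neq0.
rewrite hornerM mulf_eq0 negb_or !bundle_lineE; set s := s1 + _.
move=> /andP[pus qus].
have /pX[] : vanish X (bundle_slice s p * bundle_slice s q).
- by move=> u Xu; rewrite mevalM !bundle_sliceE -rmorphM; exact: pq0.
- by move=> /(_ _ Xu1) /eqP; rewrite bundle_sliceE; exact/negP.
- by move=> /(_ _ Xu2) /eqP; rewrite bundle_sliceE; exact/negP.
Qed.

Lemma bundle_field : prime_vanish X ->
  exists (L : fieldType) (phi : {rmorphism {mpoly {mpoly K[r.+1]}[n.+1]} -> L}),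
    (forall p, phi p = 0 <-> vanish_bundle p) /\
    (forall z, exists p q, phi q <> 0 /\ z = phi p / phi q).
Proof.
move=> pX; have [[u Xu] _] := pX; apply: function_field => [u' s _|||p q].
- exact: rmorph0.
- by move=> /(_ u 0 Xu) /eqP; rewrite rmorph1 oner_eq0.
- by move=> a p q hp hq u' s Xu'; rewrite rmorphD rmorphM /= hp // hq // mulr0 addr0.
- exact: bundle_prime.
Qed.

Lemma vfield_comb (V : 'I_n.+1 -> 'I_r.+1 -> {mpoly K[r.+1]}) s F :
  vfield (fun k => \sum_a s 0 a *: V a k) F = \sum_a s 0 a *: vfield (V a) F.
Proof.
rewrite /vfield; under eq_bigr => k _ do rewrite mulr_suml.
rewrite exchange_big /=; apply: eq_bigr => a _; rewrite scaler_sumr.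
by apply: eq_bigr => k _; rewrite scalerAl.
Qed.

Section Osculating.
Variables (V : 'I_n.+1 -> 'I_r.+1 -> {mpoly K[r.+1]}) (h : {mpoly K[r.+1]}).
Variable f : 'I_n.+1 -> {mpoly K[r.+1]}.
Hypotheses (coneX : cone X) (primeX : prime_vanish X) (dimX : has_dim X n).
Hypothesis h_nz : ~ vanish X h.
Hypothesis tangent_V : forall i F, vanish X F -> vanish X (vfield (V i) F).
Hypothesis V_f : forall i j, vanish X (vfield (V i) (f j) - (i == j)%:R * h).
Hypothesis n_gt0 : (1 <= n)%N.
Hypothesis tau_sec : tangent_variety X = secant_variety X.

Let w s k : {mpoly K[r.+1]} := \sum_a s 0 a *: V a k.

Let w_at s u k : (w s k).@[u 0] = (s *m mx_at (vfield_mx V) u) 0 k.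
Proof.
rewrite mxE (raddf_sum (meval (u 0))); apply: eq_bigr => a _.
by rewrite /= mevalZ !mxE.
Qed.

Let w_tangent s F : vanish X F -> vanish X (vfield (w s) F).
Proof.
move=> XF u Xu; rewrite vfield_comb (raddf_sum (meval (u 0))) big1 // => a _.
by rewrite /= mevalZ tangent_V ?mulr0.
Qed.

(** D^3 x for D = \sum_a s_a V_a, a field for which the s_a are constants; hence a cubic form in
    s. *)
Definition third_derivative k : {mpoly {mpoly K[r.+1]}[n.+1]} :=
  \sum_a \sum_b \sum_c
     'X_a * 'X_b * 'X_c * (vfield (V a) (vfield (V b) (V c k)))%:MP.

Lemma third_derivativeE u s k : meval_bundle u s (third_derivative k) =
  (vfield (w s) (vfield (w s) (w s k))).@[u 0].
Proof.
rewrite vfield_comb (raddf_sum (meval (u 0))) (raddf_sum (meval_bundle u s)).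
apply: eq_bigr => a _; rewrite /= mevalZ vfield_comb.
rewrite (raddf_sum (vfield (V a))) (raddf_sum (meval (u 0))) [RHS]mulr_sumr.
rewrite (raddf_sum (meval_bundle u s)); apply: eq_bigr => b _.
rewrite /= vfieldZ mevalZ (raddf_sum (vfield (V b))) (raddf_sum (vfield (V a))).
rewrite (raddf_sum (meval (u 0))) !mulr_sumr (raddf_sum (meval_bundle u s)).
apply: eq_bigr => c _; rewrite /= !vfieldZ mevalZ !rmorphM /=.
by rewrite !meval_bundleX meval_bundleC !mulrA.
Qed.

Let tangent_point k : {mpoly {mpoly K[r.+1]}[n.+1]} := \sum_a 'X_a * (V a k)%:MP.

Let tangent_pointE u s k : meval_bundle u s (tangent_point k) = (w s k).@[u 0].
Proof.
rewrite (raddf_sum (meval_bundle u s)) (raddf_sum (meval (u 0))).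
apply: eq_bigr => a _; rewrite /= mevalZ rmorphM /=.
by rewrite meval_bundleX meval_bundleC.
Qed.

(** Scaling s passes the vanishing from [Q] to its homogeneous components, to which [chord_vanish]
    and [chord_identity] apply. *)
Lemma tangent_identity Q :
  (forall u s, X u -> Q.@[fun k => (w s k).@[u 0]] = 0) ->
  forall u s, X u -> \sum_k Q^`M(k).@[fun k => (w s k).@[u 0]] *
                     (vfield (w s) (vfield (w s) (w s k))).@[u 0] = 0.
Proof.
move=> Q0 u s Xu.
have Qd d u' s' : X u' -> (hcomp d Q).@[(s' *m mx_at (vfield_mx V) u') 0] = 0.
  move=> Xu'; apply: (meval_homog_comp char0) => t _.
  rewrite -[RHS](Q0 u' (t *: s') Xu'); apply: meval_eq => k.
  by rewrite w_at -scalemxAl [RHS]mxE.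
have Id d : \sum_k (hcomp d Q)^`M(k).@[fun k => (w s k).@[u 0]] *
                     (vfield (w s) (vfield (w s) (w s k))).@[u 0] = 0.
  have hom := pihomogP [measure of mdeg] d Q.
  apply: (chord_identity char0 (w_tangent s) hom _ Xu).
  exact: (chord_vanish coneX primeX dimX h_nz tangent_V V_f n_gt0 tau_sec hom (Qd d)).
rewrite [Q](pihomog_partitionE (mf := [measure of mdeg]) (leqnn _)).
transitivity (\sum_(d < mmeasure [measure of mdeg] Q) \sum_k
   (hcomp d Q)^`M(k).@[fun k => (w s k).@[u 0]] * (vfield (w s) (vfield (w s) (w s k))).@[u 0]); last first.
  by rewrite big1.
rewrite exchange_big /=; apply: eq_bigr => k _.
by rewrite (raddf_sum (mderiv k)) (raddf_sum (meval _)) [LHS]mulr_suml.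
Qed.

(* Sending the generic point p of tau(X) to the third derivative defines a
   derivation on the function field of tau(X); extended to the function field
   of the tangent bundle, it is the differential of (x, s) |->
   \sum_j s_j V_j(x) applied to a vector field. *)
Lemma third_derivative_osculating :
  exists (d : {mpoly {mpoly K[r.+1]}[n.+1]})
         (b : 'I_n.+1 -> {mpoly {mpoly K[r.+1]}[n.+1]})
         (e : 'I_n.+1 -> 'I_n.+1 -> {mpoly {mpoly K[r.+1]}[n.+1]}),
    ~ vanish_bundle d /\ forall k, vanish_bundle (d * third_derivative k -
       (\sum_j b j * (V j k)%:MP + \sum_j \sum_i e j i * (vfield (V i) (V j k))%:MP)).
Proof.
have [L [phi [phi0 frac]]] := bundle_field primeX.
have [[u0 Xu0] _] := primeX.
have charL k : (k.+1%:R : L) != 0.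
  apply/eqP; rewrite -(rmorph_nat phi) => /phi0 /(_ u0 0 Xu0) /eqP.
  by rewrite rmorph_nat; exact/negP/char0.
pose psi : {rmorphism {mpoly K[r.+1]} -> L} := phi \o @mpolyC n.+1 _.
have psi0 F : psi F = 0 <-> vanish X F.
  split=> [/phi0 h0 u Xu|h0]; first by rewrite -(meval_bundleC u 0) h0.
  by apply/phi0 => u s Xu; rewrite meval_bundleC h0.
(* The kernel of [ev] is the ideal of tau(X); [dev] below is the candidate derivation on its image,
   with values in [L]. *)
pose ev Q := mmap (psi \o @mpolyC r.+1 K) (fun k => phi (tangent_point k)) Q.
have ev0 Q : ev Q = 0 <-> forall u s, X u -> Q.@[fun k => (w s k).@[u 0]] = 0.
  pose T := mmap (@mpolyC n.+1 _ \o @mpolyC r.+1 K) tangent_point Q.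
  have -> : ev Q = phi T by apply/esym/rmorph_mmap.
  have TE u s : meval_bundle u s T = Q.@[fun k => (w s k).@[u 0]].
    apply: (rmorph_mmap (psi := meval_bundle u s) (c' := idfun)) => [a|k] /=.
      by rewrite meval_bundleC mevalC.
    exact: tangent_pointE.
  by split=> [/phi0 h0 u s Xu|h0]; [rewrite -TE h0|apply/phi0 => u s Xu; rewrite TE h0].
pose dev Q := \sum_k ev Q^`M(k) * phi (third_derivative k).
have dev0 Q : ev Q = 0 -> dev Q = 0.
  move=> /ev0 /tangent_identity Q0.
  pose T k := mmap (@mpolyC n.+1 _ \o @mpolyC r.+1 K) tangent_point Q^`M(k).
  have -> : dev Q = phi (\sum_k T k * third_derivative k).
    rewrite rmorph_sum; apply: eq_bigr => k _; rewrite rmorphM; congr (_ * _).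
    exact/esym/rmorph_mmap.
  apply/phi0 => u s Xu; rewrite -[RHS](Q0 u s Xu) (raddf_sum (meval_bundle u s)).
  apply: eq_bigr => k _; rewrite /= rmorphM /= third_derivativeE; congr (_ * _).
  apply: (rmorph_mmap (psi := meval_bundle u s) (c' := idfun)) => [a|j] /=.
    by rewrite meval_bundleC mevalC.
  exact: tangent_pointE.
pose M : set (L * L) := fun a => exists Q, a = (ev Q, dev Q).
have gM : dual_graph M.
  split.
  - exists 1; rewrite /dev /ev rmorph1 big1 // => k _.
    by rewrite -mpolyC1 mderivC mmap0 mul0r.
  - move=> a b [Q ->] [Q' ->]; exists (Q - Q'); rewrite /dev /= /ev rmorphB -sumrB.
    by congr (_, _); apply: eq_bigr => k _; rewrite mderivB rmorphB mulrBl.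
  - move=> a b [Q ->] [Q' ->]; exists (Q * Q'); rewrite /dev /= /ev rmorphM.
    congr (_, _); rewrite !mulr_sumr -big_split /=; apply: eq_bigr => k _.
    by rewrite mderivM rmorphD /= !rmorphM /=; ring.
  - by move=> b [Q [/esym /dev0 + ->]].
have [D [dD DM]] := derivation_extension charL gM.
have Dc a : D (psi a%:MP) = 0.
  have /DM // : M (psi a%:MP, 0).
  exists a%:MP; rewrite /dev /ev mmapC big1 // => k _.
  by rewrite mderivC mmap0 mul0r.
have Dp k : D (phi (tangent_point k)) = phi (third_derivative k).
  have /DM // : M (phi (tangent_point k), phi (third_derivative k)).
  exists 'X_k; rewrite /dev /ev mmapX mmap1U (bigD1 k) //= big1 => [|j jk].
    by rewrite mderivXU eqxx rmorph1 mul1r addr0.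
  by rewrite mderivXU eq_sym (negPf jk) rmorph0 mul0r.
have Dpsi F : D (psi F) = \sum_k psi F^`M(k) * D (psi 'X_k).
  rewrite [psi F](meval_mmap psi) (derivation_mmap (c := psi \o @mpolyC r.+1 K) _ _ dD Dc).
  by apply: eq_bigr => k _; rewrite -(meval_mmap psi).
have [x1 ns1] := exists_nonsingular coneX primeX dimX n_gt0 tau_sec.
have [k [F [kn eF /row_freeP[C JC]]]] := nonsingular_jacobian dimX ns1.
have Xx1 : X x1 by case: ns1.
(* The dimension count at a nonsingular point, repeated over [L]: the point [x1] shows that the
   Jacobian has full rank generically. Hence D x is an [L]-combination of the V_i. *)
pose JL := map_mx psi (jacobian F); pose VL := map_mx psi (vfield_mx V).
have fJ : row_free JL.
  pose PC := map_mx (@mpolyC r.+1 K) C; pose B := jacobian F *m PC.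
  have detB : psi (\det B) != 0.
    apply/eqP => /psi0 /(_ _ Xx1); rewrite -det_map_mx map_mxM.
    rewrite (_ : map_mx (meval (x1 0)) PC = C) ?JC ?det1; first by move/eqP; rewrite oner_eq0.
    by apply/matrixP => i j; rewrite !mxE /= mevalC.
  have /row_freeP[E hE] : row_free (JL *m map_mx psi PC).
    by rewrite row_free_unit unitmxE unitfE -map_mxM det_map_mx.
  by apply/row_freeP; exists (map_mx psi PC *m E); rewrite mulmxA.
have fV : row_free VL.
  have h0 : psi h != 0 by apply/eqP => /psi0.
  apply/row_freeP; exists (\matrix_(l, j) (psi (f j)^`M(l) / psi h)).
  apply/matrixP => i j; rewrite !mxE.
  have /eqP := (psi0 _).2 (V_f i j); rewrite rmorphB rmorphM rmorph_nat subr_eq0 => /eqP e.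
  transitivity (psi (vfield (V i) (f j)) / psi h); last by rewrite e mulfK.
  rewrite /vfield rmorph_sum mulr_suml; apply: eq_bigr => l _.
  by rewrite !mxE rmorphM /= mulrA.
have VJ : VL *m JL^T = 0.
  apply/matrixP => i j; rewrite !mxE -[RHS]((psi0 _).2 (tangent_V i (eF j).1)).
  by rewrite /vfield rmorph_sum; apply: eq_bigr => l _; rewrite !mxE rmorphM.
have /submxP[a ea] : ((\row_l D (psi 'X_l)) <= VL)%MS.
  apply: kernel_sub_row kn fV fJ VJ _ _; apply/rowP => i; rewrite !mxE.
  have /psi0 e := (eF i).1; transitivity (D (psi (F i))); last by rewrite e (drv0 dD).
  rewrite Dpsi.
  by apply: eq_bigr => l _; rewrite !mxE mulrC.
have Dx l : D (psi 'X_l) = \sum_i a 0 i * psi (V i l).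
  have := congr1 (fun A : 'rV_r.+1 => A 0 l) ea; rewrite !mxE => ->.
  by apply: eq_bigr => i _; rewrite !mxE.
have DV F' : D (psi F') = \sum_i a 0 i * psi (vfield (V i) F').
  rewrite Dpsi; under eq_bigr => l _ do rewrite Dx mulr_sumr.
  rewrite exchange_big; apply: eq_bigr => i _; rewrite rmorph_sum mulr_sumr.
  by apply: eq_bigr => l _; rewrite rmorphM mulrCA [psi (V i l) * _]mulrC.
(* The coefficients in the Leibniz expansion of D(\sum_j s_j V_j): D s_j in front of V_j, and s_j
   a_i in front of V_i V_j. Clearing denominators turns them into [b] and [e]. *)
pose z (c : 'I_n.+1 + 'I_n.+1 * 'I_n.+1) := match c with
  | inl j => D (phi 'X_j) | inr (j, i) => phi 'X_j * a 0 i end.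
have [d [g [d0 Hg]]] := common_denominator z frac.
exists d, (fun j => g (inl j)), (fun j i => g (inr (j, i))); split.
  by move/phi0.
move=> l; apply/phi0; rewrite rmorphB rmorphM -Dp; apply/eqP; rewrite subr_eq0.
apply/eqP; rewrite rmorphD !rmorph_sum (drv_sum dD) mulr_sumr -big_split /=.
apply: eq_bigr => j _; rewrite [phi ('X_j * _)]rmorphM (drvM dD) mulrDr addrC.
congr (_ + _); last first.
  by rewrite rmorphM Hg /= -mulrA; congr (_ * _); rewrite mulrC.
rewrite -[phi (V j l)%:MP]/(psi _) DV !mulr_sumr rmorph_sum; apply: eq_bigr => i _.
by rewrite rmorphM Hg /= !mulrA.
Qed.

End Osculating.
End TangentBundle.

(** * Linear forms vanishing to order three *)

Section VanishingOrder.
Variables (B K : comNzRingType) (T : set (B -> B)) (ev : {rmorphism B -> K}).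
Hypothesis dT : forall D, T D -> derivation D.

(** When the derivations in [T] preserve the ideal of [X], polynomials vanishing on [X] have every
    order at a point of [X], so orders along [X] are computed without a quotient ring. *)
Fixpoint order_ge (k : nat) (F : B) : Prop :=
  if k is k'.+1 then ev F = 0 /\ forall D, T D -> order_ge k' (D F) else True.

Lemma order_geW k F : order_ge k.+1 F -> order_ge k F.
Proof.
elim: k F => // k IH F [F0 DF]; split=> // D TD; apply: IH; exact: DF.
Qed.

Lemma order_ge0 k : order_ge k 0.
Proof.
elim: k => // k IH; split=> [|D TD]; first exact: rmorph0.
by rewrite (drv0 (dT TD)).
Qed.

Lemma order_geD k F G : order_ge k F -> order_ge k G -> order_ge k (F + G).
Proof.
elim: k F G => // k IH F G [F0 DF] [G0 DG]; split=> [|D TD].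
  by rewrite rmorphD /= F0 G0 addr0.
by rewrite (drvD (dT TD)); apply: IH; [exact: DF|exact: DG].
Qed.

Lemma order_geN k F : order_ge k F -> order_ge k (- F).
Proof.
elim: k F => // k IH F [F0 DF]; split=> [|D TD]; first by rewrite rmorphN /= F0 oppr0.
by rewrite (drvN (dT TD)); apply: IH; exact: DF.
Qed.

Lemma order_geM a b F G : order_ge a F -> order_ge b G -> order_ge (a + b) (F * G).
Proof.
have [c] := ubnP (a + b); elim: c a b F G => // c IH [|a] b F G.
  rewrite add0n; case: b => // b bc _ [G0 DG]; split=> [|D TD].
    by rewrite rmorphM /= G0 mulr0.
  rewrite (drvM (dT TD)); apply: order_geD.
    by apply: (IH 0%N b) => //; exact: DG.
  by rewrite mulrC; apply: (IH 0%N b) => //; apply: order_geW.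
move=> abc [F0 DF] oG; split=> [|D TD]; first by rewrite rmorphM /= F0 mul0r.
rewrite (drvM (dT TD)); apply: order_geD; last first.
  by rewrite mulrC; apply: IH oG => //; exact: DF.
case: b abc oG => [|b] abc oG.
  by apply: IH => //; exact: order_geW.
have oDG : order_ge b (D G) by case: oG => _; apply.
rewrite addnS -addSn; apply: IH oDG => //; by rewrite addnS ltnS in abc.
Qed.

Lemma order_ge_sum k (J : Type) (s : seq J) (F : J -> B) :
  (forall j, order_ge k (F j)) -> order_ge k (\sum_(j <- s) F j).
Proof.
move=> oF; elim/big_rec: _ => [|j G _ oG]; [exact: order_ge0|exact: order_geD].
Qed.

(** H D(F) = D(HF) - F D(H), and the order of the last term is known by induction. *)
Lemma order_ge_divl k H F : GRing.lreg (ev H) ->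
  order_ge k (H * F) -> order_ge k F.
Proof.
move=> H0; elim: k F => // k IH F oHF.
have oF : order_ge k F by apply: IH; exact: order_geW.
have [HF0 DHF] := oHF; split=> [|D TD].
  by apply: H0; rewrite mulr0 -rmorphM.
apply: IH; rewrite -[H * D F](addrK (F * D H)); apply: order_geD.
  by rewrite -(drvM (dT TD)); exact: DHF.
by apply: order_geN; rewrite -[k]addn0; apply: order_geM.
Qed.

End VanishingOrder.

Section ThirdLeibniz.
Variables (B K : comNzRingType) (D : B -> B) (ev : {rmorphism B -> K}).
Hypothesis dD : derivation D.

(** Each vanishing factor must receive exactly one of the three derivatives, hence 3! surviving
    terms. *)
Lemma deriv3_cubic C F0 F1 F2 : ev F0 = 0 -> ev F1 = 0 -> ev F2 = 0 ->
  ev (D (D (D (C * (F0 * (F1 * F2)))))) = 6%:R * (ev C * (ev (D F0) * (ev (D F1) * ev (D F2)))).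
Proof.
move=> e0 e1 e2; rewrite !(drvM dD, drvD dD) !(rmorphD, rmorphM) /= e0 e1 e2; ring.
Qed.

Lemma deriv3_unit H F : ev F = 0 -> ev (D F) = 0 -> ev (D (D F)) = 0 ->
  ev (D (D (D (H * F)))) = ev H * ev (D (D (D F))).
Proof.
move=> e0 e1 e2; rewrite !(drvM dD, drvD dD) !(rmorphD, rmorphM) /= e0 e1 e2; ring.
Qed.

End ThirdLeibniz.


(** * Cubic terms of linear forms along X *)

Section CubicForm.
Variables (K : closedFieldType) (r : nat).
Hypothesis char0 : forall m, (m.+1%:R : K) != 0.
Implicit Types (X : set 'rV[K]_r.+1) (F G H : {mpoly K[r.+1]}) (u v x : 'rV[K]_r.+1).

Definition directional x v F : K := \sum_k F^`M(k).@[x 0] * v 0 k.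

Lemma directional_vfield x v F (w : 'I_r.+1 -> {mpoly K[r.+1]}) :
  (forall k, (w k).@[x 0] = v 0 k) -> (vfield w F).@[x 0] = directional x v F.
Proof.
move=> wv; rewrite (raddf_sum (meval (x 0))); apply: eq_bigr => k _.
by rewrite /= mevalM wv mulrC.
Qed.

Lemma directionalB x v F G : directional x v (F - G) = directional x v F - directional x v G.
Proof. by rewrite /directional -sumrB; apply: eq_bigr => k _; rewrite mderivB mevalB mulrBl. Qed.

Lemma directionalM x v F G : directional x v (F * G) =
  F.@[x 0] * directional x v G + G.@[x 0] * directional x v F.
Proof.
rewrite /directional [X in X + _]mulr_sumr [X in _ + X]mulr_sumr -big_split /=.
by apply: eq_bigr => k _; rewrite mderivM mevalD !mevalM; ring.
Qed.

Definition scale_poly (t : K) : {mpoly K[r.+1]} -> {mpoly K[r.+1]} :=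
  mmap (@mpolyC r.+1 K) (fun i => t *: 'X_i).

HB.instance Definition _ t := GRing.RMorphism.on (scale_poly t).

Lemma scale_poly_at t u F : (scale_poly t F).@[u 0] = F.@[(t *: u) 0].
Proof.
apply: (rmorph_mmap (psi := meval (u 0)) (c' := idfun)) => [a|i] /=.
  by rewrite mevalC.
by rewrite mevalZ mevalXU mxE.
Qed.

Lemma mderiv_derivation (k : 'I_r.+1) : derivation (@mderiv r.+1 K k).
Proof. by split=> F G; rewrite ?mderivD // mderivM addrC [G * _]mulrC. Qed.

Lemma mderiv_scale_poly t F k : (scale_poly t F)^`M(k) = t *: scale_poly t F^`M(k).
Proof.
rewrite (derivation_mmap _ _ (mderiv_derivation k)) => [|a]; last exact: mderivC.
rewrite (bigD1 k) //= big1 => [|j jk].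
  by rewrite mderivZ mderivXU eqxx addr0 -scalerAr mulr1.
by rewrite mderivZ mderivXU (negPf jk) scaler0 mulr0.
Qed.

Lemma mderiv_homog_scale d G t u k : G \is d.-homog ->
  t * G^`M(k).@[(t *: u) 0] = t ^+ d * G^`M(k).@[u 0].
Proof.
move=> Gd; have e : scale_poly t G = t ^+ d *: G.
  rewrite -mul_mpolyC rmorphXn /= -[G in RHS]comp_mpoly_id -(mmap_homog _ _ _ Gd).
  by apply: eq_mmap => // i; rewrite tnth_mktuple mul_mpolyC.
have := congr1 (fun E => (E^`M(k)).@[u 0]) e.
by rewrite mderiv_scale_poly mderivZ !mevalZ scale_poly_at.
Qed.

Lemma proj_tangent_scale X x v t : t != 0 ->
  proj_tangent X x v -> proj_tangent X (t *: x) v.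
Proof.
move=> t0 Tv d F Fd XF; apply: (mulfI t0); rewrite mulr0 mulr_sumr.
under eq_bigr => k _ do rewrite mulrA (mderiv_homog_scale _ _ _ Fd) -mulrA.
by rewrite -mulr_sumr (Tv d F Fd XF) mulr0.
Qed.

Lemma directional_vanish X x v F : cone X -> proj_tangent X x v ->
  vanish X F -> directional x v F = 0.
Proof.
move=> coneX Tv XF.
have XFd d : vanish X (hcomp d F).
  move=> u Xu; apply: (meval_homog_comp char0) => t t0.
  by rewrite -[RHS](XF _ (coneX.2 _ _ Xu t0)) meval_scale.
rewrite [F](pihomog_partitionE (mf := [measure of mdeg]) (leqnn _)) /directional.
under eq_bigr => k _ do rewrite (raddf_sum (mderiv k)) (raddf_sum (meval (x 0))) big_distrl.
rewrite exchange_big big1 // => d _.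
exact: Tv (pihomogP _ _ _) (XFd d).
Qed.

(* The relation says, with denominators cleared, that the linear form l vanishes
   to order 3 at x along X. *)
Definition no_cubic_term X x : Prop :=
  forall (l : 'I_r.+1 -> K) N (C : 'I_N -> {mpoly K[r.+1]})
    (F : 'I_N -> 'I_3 -> {mpoly K[r.+1]}) H,
  H.@[x 0] != 0 -> (forall m j, (F m j).@[x 0] = 0) ->
  vanish X (H * \sum_k l k *: 'X_k - \sum_m C m * \prod_j F m j) ->
  forall v, proj_tangent X x v ->
  \sum_m (C m).@[x 0] * \prod_j directional x v (F m j) = 0.

(** Conditions such as h(x) != 0 may hold only for some representative of a point. Composing all
    data with the homothety of ratio 1/t moves a relation from x to tx and multiplies its cubic term
    by t^-3. *)
Lemma no_cubic_term_scale X x t : cone X -> t != 0 ->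
  no_cubic_term X (t *: x) -> no_cubic_term X x.
Proof.
move=> coneX t0 nc l N C F H Hx Fx E v Tv.
have sc_at G : (scale_poly t^-1 G).@[(t *: x) 0] = G.@[x 0].
  by rewrite scale_poly_at scalerA mulVf // scale1r.
have dir_sc G : directional (t *: x) v (scale_poly t^-1 G) = t^-1 * directional x v G.
  rewrite /directional [RHS]mulr_sumr; apply: eq_bigr => k _.
  by rewrite mderiv_scale_poly mevalZ sc_at mulrA.
have := nc (fun k => t^-1 * l k) N (fun m => scale_poly t^-1 (C m))
  (fun m j => scale_poly t^-1 (F m j)) (scale_poly t^-1 H).
rewrite sc_at => /(_ Hx).
have Fx' m j : (scale_poly t^-1 (F m j)).@[(t *: x) 0] = 0 by rewrite sc_at.
move=> /(_ Fx') H1.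
have E' : vanish X (scale_poly t^-1 H * \sum_k (t^-1 * l k) *: 'X_k -
    \sum_m scale_poly t^-1 (C m) * \prod_j scale_poly t^-1 (F m j)).
  move=> u Xu; rewrite -[RHS](E (t^-1 *: u)) -?scale_poly_at; last first.
    by apply: (coneX.2 _ _ Xu); rewrite invr_eq0.
  congr (_.@[_]); rewrite rmorphB rmorphM !rmorph_sum /=; congr (_ * _ - _).
    apply: eq_bigr => k _; rewrite -[l k *: _]mul_mpolyC [RHS]rmorphM /=.
    by rewrite /scale_poly mmapC mmapX mmap1U mul_mpolyC scalerA [l k * _]mulrC.
  by apply: eq_bigr => m _; rewrite rmorphM rmorph_prod.
have := H1 E' v (proj_tangent_scale t0 Tv).
under eq_bigr => m _ do rewrite sc_at.
have prodE m : \prod_j directional (t *: x) v (scale_poly t^-1 (F m j)) =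
    (t^-1) ^+ 3 * \prod_j directional x v (F m j).
  under eq_bigr => j _ do rewrite dir_sc.
  by rewrite big_split /= prodr_const card_ord.
under eq_bigr => m _ do rewrite prodE mulrCA.
rewrite -mulr_sumr => /eqP; rewrite mulf_eq0 expf_eq0 invr_eq0 (negPf t0) andbF.
by move/eqP.
Qed.

Section GoodPoint.
Variables (X : set 'rV[K]_r.+1) (n : nat).
Variables (V : 'I_n.+1 -> 'I_r.+1 -> {mpoly K[r.+1]}).
Hypothesis tangent_V : forall i F, vanish X F -> vanish X (vfield (V i) F).
Variables (d : {mpoly {mpoly K[r.+1]}[n.+1]})
  (b : 'I_n.+1 -> {mpoly {mpoly K[r.+1]}[n.+1]})
  (e : 'I_n.+1 -> 'I_n.+1 -> {mpoly {mpoly K[r.+1]}[n.+1]}).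
Hypothesis osculating : forall k, vanish_bundle X (d * third_derivative V k -
  (\sum_j b j * (V j k)%:MP + \sum_j \sum_i e j i * (vfield (V i) (V j k))%:MP)).

(** The relation makes the linear form vanish to order 3 at x, so it kills V_j and V_i V_j there
    and, by [osculating], D^3 x. Applying D three times to the relation then leaves only 6 times the
    cubic term. *)
Lemma good_no_cubic_term x (s0 : 'rV[K]_n.+1) : X x ->
  meval_bundle x s0 d != 0 ->
  (forall v, proj_tangent X x v -> (v <= mx_at (vfield_mx V) x)%MS) ->
  no_cubic_term X x.
Proof.
move=> Xx ds0 span l N C F H Hx Fx E v /span/submxP[s ->].
pose lin : {mpoly K[r.+1]} := \sum_k l k *: 'X_k.
pose w s' k : {mpoly K[r.+1]} := \sum_a (s' : 'rV[K]_n.+1) 0 a *: V a k.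
have w_tangent s' G : vanish X G -> vanish X (vfield (w s') G).
  move=> XG u Xu; rewrite vfield_comb (raddf_sum (meval (u 0))) big1 // => a _.
  by rewrite /= mevalZ tangent_V ?mulr0.
pose T : set ({mpoly K[r.+1]} -> {mpoly K[r.+1]}) :=
  fun D => derivation D /\ forall G, vanish X G -> vanish X (D G).
have dT D : T D -> derivation D by case.
have TV i : T (vfield (V i)) by split; [exact: vfield_derivation|exact: tangent_V].
have Tw : T (vfield (w s)) by split; [exact: vfield_derivation|exact: w_tangent].
pose ge k G := order_ge T (meval (x 0)) k G.
have ge_vanish k G : vanish X G -> ge k G.
  elim: k G => // k IH G XG; split=> [|D [_ TD]]; first exact: XG.
  by apply: IH; exact: TD.
have geF m j : ge 1%N (F m j) by split=> //; exact: Fx.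
have ge_cubic : ge 3%N (\sum_m C m * \prod_j F m j).
  apply: order_ge_sum => // m; rewrite -[3%N]/(0 + 3)%N; apply: order_geM => //.
  rewrite !big_ord_recl big_ord0 mulr1 -[3%N]/(1 + (1 + 1))%N.
  by apply: order_geM; [|exact: geF|apply: order_geM; [|exact: geF|exact: geF]].
have ge_lin : ge 3%N lin.
  apply: (order_ge_divl dT (H := H)); first by apply/lregP.
  rewrite -[H * lin](subrK (\sum_m C m * \prod_j F m j)).
  by apply: (order_geD dT _ ge_cubic); exact (ge_vanish 3%N _ E).
have vlin w' : vfield w' lin = \sum_k l k *: w' k.
  rewrite (raddf_sum (vfield w')); apply: eq_bigr => k _.
  by rewrite /= vfieldZ vfieldX.
have l1 j : \sum_k l k * (V j k).@[x 0] = 0.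
  have [_ /(_ _ (TV j))[e0 _]] := ge_lin; rewrite -[RHS]e0 vlin (raddf_sum (meval (x 0))).
  by apply: eq_bigr => k _; rewrite /= mevalZ.
have l2 i j : \sum_k l k * (vfield (V i) (V j k)).@[x 0] = 0.
  have [_ /(_ _ (TV j))[_ /(_ _ (TV i))[e0 _]]] := ge_lin.
  rewrite -[RHS]e0 vlin (raddf_sum (vfield (V i))) (raddf_sum (meval (x 0))).
  by apply: eq_bigr => k _; rewrite /= vfieldZ mevalZ.
pose Tl : {mpoly {mpoly K[r.+1]}[n.+1]} := \sum_k ((l k)%:MP)%:MP * third_derivative V k.
have dTl s' : meval_bundle x s' (d * Tl) = 0.
  pose ev := meval_bundle x s'.
  have hk k : ev d * ev (third_derivative V k) =
      \sum_j ev (b j) * (V j k).@[x 0] + \sum_j \sum_i ev (e j i) * (vfield (V i) (V j k)).@[x 0].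
    have /eqP := osculating k s' Xx; rewrite rmorphB rmorphM rmorphD subr_eq0 => /eqP /= ->.
    rewrite !rmorph_sum; congr (_ + _); apply: eq_bigr => j _.
      by rewrite rmorphM /= meval_bundleC.
    by rewrite rmorph_sum; apply: eq_bigr => i _; rewrite rmorphM /= meval_bundleC.
  rewrite rmorphM rmorph_sum [LHS]mulr_sumr.
  under eq_bigr => k _ do rewrite rmorphM /= meval_bundleC mevalC mulrCA hk
    mulrDr mulr_sumr mulr_sumr.
  rewrite big_split /= exchange_big [X in X + _]big1 => [|j _]; last first.
    under eq_bigr => k _ do rewrite mulrCA.
    by rewrite -mulr_sumr l1 mulr0.
  rewrite add0r exchange_big big1 // => j _.
  under eq_bigr => k _ do rewrite mulr_sumr.
  rewrite exchange_big big1 // => i _.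
  under eq_bigr => k _ do rewrite mulrCA.
  by rewrite -mulr_sumr l2 mulr0.
(* [dTl] gives the vanishing only where d(x, s) != 0. On the line from s to [s0] the polynomial d is
   not identically zero, so it can be cancelled. *)
have Tl0 : meval_bundle x s Tl = 0.
  pose ln := bundle_line x s (s0 - s).
  have : ln d * ln Tl = 0.
    apply: (poly_eq0_char0 char0) => t.
    by rewrite hornerM !bundle_lineE -rmorphM; exact: dTl.
  move/eqP; rewrite mulf_eq0 => /orP[/eqP ld0|/eqP lT0].
    have := bundle_lineE x s (s0 - s) d 1; rewrite -/(ln d) ld0 horner0 scale1r addrC subrK.
    by move=> e0; rewrite -e0 eqxx in ds0.
  by have := bundle_lineE x s (s0 - s) Tl 0; rewrite -/(ln Tl) lT0 horner0 scale0r addr0.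
pose D := vfield (w s); have dD : derivation D by case: Tw.
have Dcomb (g : 'I_r.+1 -> {mpoly K[r.+1]}) :
    D (\sum_k l k *: g k) = \sum_k l k *: D (g k).
  by rewrite (drv_sum dD); apply: eq_bigr => k _; exact: vfieldZ.
have Dsum (g : 'I_N -> {mpoly K[r.+1]}) : D (\sum_m g m) = \sum_m D (g m).
  by rewrite (drv_sum dD).
have D3lin : (D (D (D lin))).@[x 0] = 0.
  rewrite -[RHS]Tl0 (raddf_sum (meval_bundle x s)) [D lin]vlin !Dcomb.
  rewrite (raddf_sum (meval (x 0))); apply: eq_bigr => k _.
  by rewrite /= mevalZ rmorphM /= meval_bundleC mevalC third_derivativeE.
have := w_tangent s _ (w_tangent s _ (w_tangent s _ E)) x Xx.
rewrite -/D !(drvB dD) mevalB deriv3_unit //; last 3 first.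
- by case: ge_lin.
- by case: ge_lin => _ /(_ _ Tw)[].
- by case: ge_lin => _ /(_ _ Tw)[_ /(_ _ Tw)[]].
rewrite /= -/lin D3lin mulr0 sub0r => /eqP; rewrite oppr_eq0 !Dsum.
rewrite (raddf_sum (meval (x 0))) => /eqP.
have term m : (D (D (D (C m * \prod_j F m j)))).@[x 0] =
    6%:R * ((C m).@[x 0] * \prod_j directional x (s *m mx_at (vfield_mx V) x) (F m j)).
  have DF j : (D (F m j)).@[x 0] = directional x (s *m mx_at (vfield_mx V) x) (F m j).
    apply: directional_vfield => k; rewrite mxE (raddf_sum (meval (x 0))).
    by apply: eq_bigr => a _; rewrite /= mevalZ !mxE.
  rewrite !big_ord_recl !big_ord0 !mulr1 -!DF.
  by apply: (deriv3_cubic (ev := meval (x 0))) => //; exact: Fx.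
move=> cubic0; apply: (mulfI (char0 5)); rewrite mulr0 -[RHS]cubic0 mulr_sumr.
by apply: eq_bigr => m _; exact/esym/term.
Qed.

End GoodPoint.
End CubicForm.

(** * Germs *)

Lemma sum_perm_lift (R : nmodType) n (F : 'S_n.+1 -> R) :
  \sum_(s : 'S_n.+1) F s = \sum_(i < n.+1) \sum_(s : 'S_n) F (lift_perm ord0 i s).
Proof.
rewrite (partition_big (fun s : 'S_n.+1 => s ord0) predT) //=; apply: eq_bigr => i _.
pose ulsf (s : 'S_n.+1) (k : 'I_n) : 'I_n := odflt k (unlift (s ord0) (s (lift ord0 k))).
have ulsfK (s : 'S_n.+1) k : lift (s ord0) (ulsf s k) = s (lift ord0 k).
  have [|j e1 e2] := @unlift_some _ (s ord0) (s (lift ord0 k)).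
    by rewrite (inj_eq perm_inj) neq_lift.
  by rewrite /ulsf e2 /= -e1.
have inj_ulsf (s : 'S_n.+1) : injective (ulsf s).
  move=> x y /(congr1 (lift (s ord0))); rewrite !ulsfK.
  by move/perm_inj/lift_inj.
rewrite (reindex (lift_perm ord0 i)).
  by apply: eq_bigl => s; rewrite lift_perm_id eqxx.
exists (fun s => perm (inj_ulsf s)) => [s _|s /eqP si].
  apply/permP => k; rewrite permE; apply: (@lift_inj _ i).
  by have := ulsfK (lift_perm ord0 i s) k; rewrite lift_perm_id lift_perm_lift.
apply/permP => k; case: (unliftP ord0 k) => [k'|] ->.
  by rewrite lift_perm_lift -si permE ulsfK.
by rewrite lift_perm_id si.
Qed.

(** The permanent is the coefficient of b_0 b_1 b_2 in the cubic form [q]; inclusion-exclusion over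
    0/1 vectors isolates it. *)
Lemma permanent3_polarization (R : comNzRingType) (a : 'I_3 -> 'I_3 -> R) :
  let q (b : 'I_3 -> R) := \prod_j \sum_i b i * a j i in
  let pt (b0 b1 b2 : R) (i : 'I_3) := nth 0 [:: b0; b1; b2] i in
  \sum_(s : 'S_3) \prod_j a j (s j) =
  q (pt 1 1 1) - q (pt 1 1 0) - q (pt 1 0 1) - q (pt 0 1 1)
  + q (pt 1 0 0) + q (pt 0 1 0) + q (pt 0 0 1).
Proof.
pose A x y := a (inord x) (inord y).
have aE i j : a i j = A i j by rewrite /A !inord_val.
have S0 (F : 'S_0 -> R) : \sum_s F s = F 1%g.
  rewrite (bigD1 1%g) //= big1 ?addr0 // => s; case/eqP.
  by apply/permP => -[].
have S3 (F : 'S_3 -> R) : \sum_s F s = \sum_(i < 3) \sum_(j < 2) \sum_(k < 1)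
    F (lift_perm ord0 i (lift_perm ord0 j (lift_perm ord0 k 1%g))).
  rewrite sum_perm_lift; apply: eq_bigr => i _.
  rewrite sum_perm_lift; apply: eq_bigr => j _.
  by rewrite sum_perm_lift; apply: eq_bigr => k _; rewrite S0.
move=> q pt; rewrite S3 /q /pt.
rewrite !big_ord_recl !big_ord0 /= !lift_perm_lift !lift_perm_id /= !aE /=.
rewrite /bump /=; ring.
Qed.

Section Germs.
Variables (K : closedFieldType) (r : nat).
Hypothesis char0 : forall m, (m.+1%:R : K) != 0.
Implicit Types (F G H : {mpoly K[r.+1]}) (u v x : 'rV[K]_r.+1).
Local Notation fun1 := ('rV[K]_r.+1 -> K).

(** Restriction to the slice with first point x: tangent vectors act on f(x, -), so the first point
    never moves. *)
Definition freeze x : {mpoly K[r.+1 + r.+1]} -> {mpoly K[r.+1]} :=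
  mmap (@mpolyC r.+1 K)
    (fun i => match split i with inl j => (x 0 j)%:MP | inr j => 'X_j end).

Lemma freeze_at x v (F : {mpoly K[r.+1 + r.+1]}) : (freeze x F).@[v 0] = meval2 F x v.
Proof.
apply: (rmorph_mmap (psi := meval (v 0)) (c' := idfun)) => [a|i] /=.
  by rewrite mevalC.
by rewrite mxE; case: split => j; rewrite ?mevalC ?mevalXU.
Qed.

Lemma freeze_homog x a b (F : {mpoly K[r.+1 + r.+1]}) : bihomog a b F -> freeze x F \is b.-homog.
Proof.
move=> Fab; rewrite /freeze /mmap big_seq; apply/rpred_sum => m mF.
have [_ <-] := Fab _ mF; rewrite mul_mpolyC; apply/rpredZ.
rewrite /mmap1 big_split_ord /=.
under eq_bigr => i _ do rewrite -[lshift _ _]/(unsplit (inl i)) unsplitK -rmorphXn /=.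
rewrite -rmorph_prod mul_mpolyC; apply/rpredZ.
under eq_bigr => i _ do rewrite -[rshift _ _]/(unsplit (inr i)) unsplitK.
pose m2 : 'X_{1..r.+1} := [multinom m (rshift r.+1 i) | i < r.+1].
rewrite (_ : \prod_i _ = 'X_[m2]); last first.
  by rewrite mpolyXE_id; apply: eq_bigr => i _; rewrite mnmE.
rewrite dhomogX /= mdegE; apply/eqP; apply: eq_bigr => i _.
by rewrite mnmE.
Qed.

Lemma dhomogXU (i : 'I_r.+1) : ('X_i : {mpoly K[r.+1]}) \is 1.-homog.
Proof. by rewrite dhomogX /= mdeg1. Qed.

Section AtPoint.
Variables (X : set 'rV[K]_r.+1) (x : 'rV[K]_r.+1).
Hypotheses (coneX : cone X) (Xx : X x).

Definition represents (f : fun1) G H : Prop :=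
  H.@[x 0] != 0 /\ forall u, X u -> H.@[u 0] != 0 -> f u = G.@[u 0] / H.@[u 0].

Lemma stalk2_freeze e1 e2 f : stalk2 e1 e2 X x f ->
  stalk1 e2 X x (f x) /\ exists G H, represents (f x) G H.
Proof.
move=> [a1 [a2 [b1 [b2 [G [H [[_ e] Gh Hh Hx fE]]]]]]].
have rep u : X u -> (freeze x H).@[u 0] != 0 ->
    f x u = (freeze x G).@[u 0] / (freeze x H).@[u 0].
  by move=> Xu; rewrite !freeze_at; exact: fE.
have Hx' : (freeze x H).@[x 0] != 0 by rewrite freeze_at.
split; last by exists (freeze x G), (freeze x H).
by exists a2, b2, (freeze x G), (freeze x H); split; rewrite ?freeze_homog//;
  [exact: freeze_homog Gh|exact: freeze_homog Hh].
Qed.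

Lemma common_representation (J : finType) (f : J -> fun1) :
  (forall j, exists G H, represents (f j) G H) ->
  exists H (G : J -> {mpoly K[r.+1]}), forall j, represents (f j) (G j) H.
Proof.
move=> rep; have /choice[p Hp] : forall j, exists GH : {mpoly K[r.+1]} * {mpoly K[r.+1]},
    represents (f j) GH.1 GH.2.
  by move=> j; have [G [H GH]] := rep j; exists (G, H).
exists (\prod_j (p j).2), (fun j => (p j).1 * \prod_(i | i != j) (p i).2) => j.
split; first by rewrite rmorph_prod; apply/prodf_neq0 => i _; case: (Hp i).
move=> u Xu; rewrite (bigD1 j) //= !mevalM mulf_eq0 negb_or => /andP[pu qu].
by rewrite (Hp j).2 //; field; rewrite pu qu.
Qed.

Lemma stalk1_fun0 f G H d : G \is d.-homog -> H \is d.-homog ->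
  represents f G H -> stalk1 0 X x f.
Proof. by move=> Gd Hd [Hx fE]; exists d, d, G, H; split=> //; rewrite addr0. Qed.

Lemma stalk1_0P f : stalk1 0 X x f ->
  exists d G H, [/\ G \is d.-homog, H \is d.-homog & represents f G H].
Proof.
move=> [d1 [d2 [G [H [+ Gd Hd Hx fE]]]]]; rewrite addr0 => -[e].
by exists d1, G, H; split=> //; rewrite e.
Qed.

Lemma stalk1D f g : stalk1 0 X x f -> stalk1 0 X x g -> stalk1 0 X x (fun u => f u + g u).
Proof.
move=> /stalk1_0P[d [G [H [Gd Hd [Hx fE]]]]] /stalk1_0P[d' [G' [H' [Gd' Hd' [Hx' gE]]]]].
apply: (@stalk1_fun0 _ (G * H' + H * G') (H * H') (d + d')%N).
- by rewrite rpredD ?dhomogM.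
- exact: dhomogM.
split=> [|u Xu]; first by rewrite mevalM mulf_neq0.
rewrite mevalD !mevalM mulf_eq0 negb_or => /andP[hu hu'].
by rewrite fE // gE //; field; rewrite hu hu'.
Qed.

Lemma stalk1M f g : stalk1 0 X x f -> stalk1 0 X x g -> stalk1 0 X x (fun u => f u * g u).
Proof.
move=> /stalk1_0P[d [G [H [Gd Hd [Hx fE]]]]] /stalk1_0P[d' [G' [H' [Gd' Hd' [Hx' gE]]]]].
apply: (@stalk1_fun0 _ (G * G') (H * H') (d + d')%N); rewrite ?dhomogM //.
split=> [|u Xu]; first by rewrite mevalM mulf_neq0.
rewrite !mevalM mulf_eq0 negb_or => /andP[hu hu'].
by rewrite fE // gE //; field; rewrite hu hu'.
Qed.

Lemma stalk1C c : stalk1 0 X x (fun=> c).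
Proof.
apply: (@stalk1_fun0 _ c%:MP 1 0%N); rewrite ?dhomog1 //.
  by rewrite -[c%:MP]mulr1 mul_mpolyC; apply/rpredZ/dhomog1.
by split=> [|u _ _]; rewrite !meval1 ?oner_neq0 // mevalC divr1.
Qed.

Section Derivations.
Variable t : fun1 -> K.
Hypothesis tv : tangent_vector X x t.

Let tN f g : stalk1 0 X x f -> stalk1 0 X x g ->
  near1 X x (fun u => f u = g u) -> t f = t g.
Proof. by case: tv => + _ _; apply. Qed.

Let tM f g : stalk1 0 X x f -> stalk1 0 X x g ->
  t (fun u => f u * g u) = f x * t g + g x * t f.
Proof. by case: tv => _ _; apply. Qed.

Let tC c : t (fun=> c) = 0.
Proof.
have t0 : t (fun=> 0) = 0.
  have := tM (stalk1C 0) (stalk1C 0); rewrite /= !mul0r addr0 => e.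
  by rewrite -[RHS]e; congr t; apply/funext => u; rewrite mul0r.
have t1 : t (fun=> 1) = 0.
  have := tM (stalk1C 1) (stalk1C 1); rewrite /= !mul1r => /eqP.
  by rewrite -subr_eq0 opprD addrA subrr sub0r oppr_eq0 => /eqP.
have [_ /(_ c _ _ (stalk1C 1) (stalk1C 0)) e _] := tv.
by rewrite /= t0 t1 mulr1 mulr0 !addr0 in e.
Qed.

Let tD f g : stalk1 0 X x f -> stalk1 0 X x g -> t (fun u => f u + g u) = t f + t g.
Proof.
move=> sf sg; have [_ /(_ 1 _ _ sf sg) e _] := tv; rewrite mul1r in e.
by rewrite -e; congr t; apply/funext => u; rewrite mul1r.
Qed.

(* In the affine chart x_(i0) <> 0, with coordinates y_i = u_i / u_(i0), the
   derivation t is the vector (t y_i). *)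
Lemma tangent_vector_proj_tangent : exists v, proj_tangent X x v /\
  forall f G H, stalk1 0 X x f -> f x = 0 -> represents f G H ->
    t f = directional x v G / H.@[x 0].
Proof.
have /existsP[i0 x0] : [exists i, x 0 i != 0].
  apply: contraT => /existsPn h; case/negP: (coneX.1 _ Xx); apply/eqP/rowP => j.
  by rewrite mxE; apply/eqP; have := h j; rewrite negbK.
pose y (i : 'I_r.+1) : fun1 := fun u => u 0 i / u 0 i0.
have sy i : stalk1 0 X x (y i).
  apply: (@stalk1_fun0 _ 'X_i 'X_i0 1%N); rewrite ?dhomogXU //.
  by split=> [|u _]; rewrite !mevalXU.
pose Fy F : fun1 := fun u => F.@[fun i => y i u].
have Fy_spec F : stalk1 0 X x (Fy F) /\ t (Fy F) = \sum_k Fy F^`M(k) x * t (y k).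
  elim/mpoly_ring_ind: F => [c|i|p q [sp tp] [sq tq]|p q [sp tp] [sq tq]].
  - have -> : Fy c%:MP = fun=> c by apply/funext => u; exact: mevalC.
    split; first exact: stalk1C.
    by rewrite tC big1 // => k _; rewrite mderivC /Fy meval0 mul0r.
  - have -> : Fy 'X_i = y i by apply/funext => u; exact: mevalXU.
    split=> //; rewrite (bigD1 i) //= big1 => [|k ki].
      by rewrite mderivXU eqxx /Fy meval1 mul1r addr0.
    by rewrite mderivXU eq_sym (negPf ki) /Fy meval0 mul0r.
  - have -> : Fy (p + q) = fun u => Fy p u + Fy q u by apply/funext => u; exact: mevalD.
    split; first exact: stalk1D.
    rewrite tD // tp tq -big_split /=; apply: eq_bigr => k _.
    by rewrite mderivD /Fy mevalD mulrDl.
  - have -> : Fy (p * q) = fun u => Fy p u * Fy q u by apply/funext => u; exact: mevalM.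
    split; first exact: stalk1M.
    rewrite tM // tp tq !mulr_sumr -big_split /=; apply: eq_bigr => k _.
    by rewrite mderivM /Fy mevalD !mevalM; ring.
have FyE F u : Fy F u = F.@[((u 0 i0)^-1 *: u) 0].
  by apply: meval_eq => i; rewrite mxE mulrC.
have FyH d F u : F \is d.-homog -> Fy F u = (u 0 i0)^-1 ^+ d * F.@[u 0].
  by move=> Fd; rewrite FyE (meval_scale_homog _ _ Fd).
(* The factor x_(i0) compensates the degree d - 1 of the partial derivatives and gives the exponent
   d in [tFy]. *)
pose v : 'rV[K]_r.+1 := \row_k (x 0 i0 * t (y k)).
have tFy d F : F \is d.-homog -> t (Fy F) = (x 0 i0)^-1 ^+ d * directional x v F.
  move=> Fd; rewrite (Fy_spec F).2 [RHS]mulr_sumr; apply: eq_bigr => k _.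
  rewrite mulrA -(mderiv_homog_scale _ _ _ Fd) FyE mxE; field; exact: x0.
have near_i0 (P : 'rV[K]_r.+1 -> Prop) d H : H \is d.-homog -> H.@[x 0] != 0 ->
    (forall u, X u -> H.@[u 0] != 0 -> u 0 i0 != 0 -> P u) -> near1 X x P.
  move=> Hd Hx HP; exists (d + 1)%N, (H * 'X_i0); split.
  - by rewrite dhomogM ?dhomogXU.
  - by rewrite mevalM mevalXU mulf_neq0.
  - by move=> u Xu; rewrite mevalM mevalXU mulf_eq0 negb_or => /andP[]; exact: HP.
have Tv : proj_tangent X x v.
  move=> d F Fd XF; have t0 : t (Fy F) = 0.
    rewrite -(tC 0); apply: tN; [exact: (Fy_spec F).1|exact: stalk1C|].
    apply: (near_i0 _ 0%N 1); rewrite ?dhomog1 ?meval1 ?oner_neq0 // => u Xu _ _.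
    by rewrite (FyH _ _ _ Fd) XF // mulr0.
  apply/eqP; have /eqP := tFy _ _ Fd.
  by rewrite t0 eq_sym mulf_eq0 expf_eq0 invr_eq0 (negPf x0) andbF.
exists v; split=> // f F H sf fx [Hx fE].
have [d [G' [H' [Gd' Hd' [Hx' fE']]]]] := stalk1_0P sf.
have tf : t f = directional x v G' / H'.@[x 0].
  have : t (fun u => f u * Fy H' u) = t (Fy G').
    apply: tN; [exact: stalk1M (Fy_spec _).1|exact: (Fy_spec _).1|].
    apply: (near_i0 _ _ _ Hd' Hx') => u Xu hu u0.
    by rewrite fE' // (FyH _ _ _ Hd') (FyH _ _ _ Gd'); field; exact: hu.
  rewrite (tM sf (Fy_spec H').1) fx mul0r add0r (tFy _ _ Gd') (FyH _ _ _ Hd').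
  rewrite -mulrA => /(mulfI _) e; rewrite -[directional x v G']e; last first.
    by rewrite expf_eq0 invr_eq0 (negPf x0) andbF.
  by rewrite [RHS]mulrC mulKf.
(* Two fractions for one germ, cross-multiplied; the factor HH' makes the equation hold also where a
   denominator vanishes. Its derivative along v at x compares the numerators. *)
pose E := (H * H') * (F * H' - G' * H).
have XE : vanish X E.
  move=> u Xu; rewrite /E mevalM mevalB !mevalM.
  have [->|hu] := eqVneq H.@[u 0] 0; first by rewrite !mul0r.
  have [->|hu'] := eqVneq H'.@[u 0] 0; first by rewrite mulr0 !mul0r.
  have := fE u Xu hu; rewrite (fE' u Xu hu') => /eqP.
  by rewrite eqr_div // => /eqP e; rewrite [F.@[_] * _]mulrC mulrC -e; ring.
have F0 : F.@[x 0] = 0.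
  by move: fx; rewrite fE // => /eqP; rewrite mulf_eq0 invr_eq0 (negPf Hx) orbF => /eqP.
have G0 : G'.@[x 0] = 0.
  by move: fx; rewrite fE' // => /eqP; rewrite mulf_eq0 invr_eq0 (negPf Hx') orbF => /eqP.
have := directional_vanish char0 coneX Tv XE.
rewrite directionalM mevalB !mevalM F0 G0 !mul0r subrr mul0r addr0 directionalB !directionalM.
rewrite F0 G0 !mul0r !add0r => /eqP; rewrite mulf_eq0 mulf_eq0 (negPf Hx) (negPf Hx') /=.
rewrite subr_eq0 tf => /eqP e; apply/eqP; rewrite eqr_div //; apply/eqP.
by rewrite mulrC -e mulrC.
Qed.

End Derivations.
End AtPoint.

(** With the first point fixed at x, [taylor b] is the linear form with coefficients b_k(x), and its
    expansion is a relation as in [no_cubic_term]. That property concerns the cube of one tangent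
    vector; polarization reaches products of three. *)
Lemma no_cubic_term_third_fundamental_form X x : cone X -> X x ->
  no_cubic_term X x -> third_fundamental_form_eq0 X x.
Proof.
move=> coneX Xx nc b t z _ Ht [N [c [f [[sc df nearE] ->]]]].
have rep (j : 'I_N + 'I_N * 'I_3) : exists G H,
    represents X x (match j with inl m => c m x | inr (m, j) => f m j x end) G H.
  case: j => [m|[m j]]; first by have [] := stalk2_freeze Xx (sc m).
  by have [sf _] := df m j; have [] := stalk2_freeze Xx sf.
have [H [G HG]] := common_representation rep.
pose C m := G (inl m); pose F m j := G (inr (m, j)).
have HC m : represents X x (c m x) (C m) H := HG (inl m).
have HF m j : represents X x (f m j x) (F m j) H := HG (inr (m, j)).
have [a1 [a2 [H2 [_ H2x E2]]]] := nearE.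
have [H0 [H0x H0E]] : exists H0 : {mpoly K[r.+1]},
    H0.@[x 0] != 0 /\ forall u, H0.@[u 0] = meval2 H2 x u.
  by exists (freeze x H2); split=> [|u]; rewrite freeze_at.
have sf m j : stalk1 0 X x (f m j x).
  by have [s2 _] := df m j; have [] := stalk2_freeze Xx s2.
have fx0 m j : f m j x x = 0.
  by have [_ [d [Q [_ Qx]]]] := df m j; apply.
have Fx0 m j : (F m j).@[x 0] = 0.
  have [Hx fE] := HF m j; have := fx0 m j; rewrite fE // => /eqP.
  by rewrite mulf_eq0 invr_eq0 (negPf Hx) orbF => /eqP.
(* That H is nonzero at x is known only through one of the represented germs. *)
have [N0|] := posnP N.
  by rewrite big1 // => m _; have := leq_trans (ltn_ord m) (eq_leq N0).
move=> N0; have Hx : H.@[x 0] != 0 := (HC (Ordinal N0)).1.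
pose l k := b k x.
have E : vanish X ((H0 * H * H ^+ 4) * \sum_k l k *: 'X_k - \sum_m (H0 * H * C m) * \prod_j F m j).
  move=> u Xu; rewrite mevalB !mevalM !(raddf_sum (meval (u 0))) /=.
  have [h0u|h0u] := eqVneq H0.@[u 0] 0.
    rewrite h0u !mul0r sub0r big1 ?oppr0 // => m _.
    by rewrite /= !mevalM h0u !mul0r.
  have [hu|hu] := eqVneq H.@[u 0] 0.
    rewrite hu mulr0 !mul0r sub0r big1 ?oppr0 // => m _.
    by rewrite /= !mevalM hu mulr0 !mul0r.
  have -> : \sum_k (l k *: 'X_k).@[u 0] = \sum_m c m x u * \prod_j f m j x u.
    rewrite -E2 //; last by rewrite -H0E.
    by apply: eq_bigr => k _; rewrite mevalZ mevalXU.
  apply/eqP; rewrite subr_eq0 mulr_sumr; apply/eqP; apply: eq_bigr => m _.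
  rewrite /= !mevalM rmorph_prod /= !big_ord_recl !big_ord0.
  rewrite (HC m).2 // !(HF m _).2 //; field; exact: hu.
have /choice[v Hv] := fun j => tangent_vector_proj_tangent coneX Xx (Ht j).
have Tv j := (Hv j).1.
pose a m j i := directional x (v i) (F m j).
have tf m j i : t i (f m j x) = a m j i / H.@[x 0] by exact: (Hv i).2 (sf m j) (fx0 m j) (HF m j).
have cubic (q : 'I_3 -> K) : \sum_m (C m).@[x 0] * \prod_j \sum_i q i * a m j i = 0.
  have Tq : proj_tangent X x (\sum_i q i *: v i).
    move=> d Q Qd XQ; under eq_bigr => k _ do rewrite summxE mulr_sumr.
    rewrite exchange_big big1 // => i _.
    under eq_bigr => k _ do rewrite mxE mulrCA.
    by rewrite -mulr_sumr (Tv i d Q Qd XQ) mulr0.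
  have Hne : (H0 * H * H ^+ 4).@[x 0] != 0.
    by rewrite !mevalM !mulf_neq0.
  have := nc l N _ F _ Hne Fx0 E _ Tq.
  under eq_bigr => m _ do rewrite !mevalM -!mulrA.
  rewrite -!mulr_sumr => /eqP; rewrite !mulf_eq0 (negPf H0x) (negPf Hx) /= => /eqP e0.
  rewrite -[RHS]e0; apply: eq_bigr => m _; congr (_ * _); apply: eq_bigr => j _.
  rewrite /directional; under [RHS]eq_bigr => k _ do rewrite summxE mulr_sumr.
  rewrite [RHS]exchange_big; apply: eq_bigr => i _; rewrite mulr_sumr.
  by apply: eq_bigr => k _; rewrite mxE mulrCA.
have termE m : c m x x * \sum_(s : 'S_3) \prod_j t (s j) (f m j x) =
    (H.@[x 0])^-1 ^+ 4 * ((C m).@[x 0] * \sum_(s : 'S_3) \prod_j a m j (s j)).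
  rewrite (HC m).2 // !mulr_sumr; apply: eq_bigr => s _.
  under eq_bigr => j _ do rewrite tf.
  by rewrite big_split /= prodr_const card_ord exprS; ring.
under eq_bigr => m _ do rewrite termE permanent3_polarization.
rewrite -mulr_sumr.
under eq_bigr => m _ do rewrite !(mulrDr, mulrN).
by rewrite !big_split /= !sumrN !cubic !(oppr0, addr0) mulr0.
Qed.

End Germs.

(** * Vanishing at a generic point *)

Lemma nonsingular_scale (K : closedFieldType) r (X : set 'rV[K]_r.+1) x t :
  cone X -> t != 0 -> nonsingular X x -> nonsingular X (t *: x).
Proof.
move=> coneX t0 [Xx [n [dimX [M [fM TM]]]]]; split; first exact: coneX.2.
exists n; split=> //; exists M; split=> // v; rewrite -TM; split.
  move=> /(proj_tangent_scale (t := t^-1)); rewrite invr_eq0 scalerA mulVf // scale1r.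
  exact.
exact: proj_tangent_scale.
Qed.

(** The single polynomial h d(-, s0) witnesses all the generic conditions. A point outside its
    [zlocus] has a multiple where it is nonzero, and the absence of a cubic term descends from that
    multiple. *)
Lemma generic_third_fundamental_form (K : closedFieldType) r n
    (X : set 'rV[K]_r.+1) : (forall m, (m.+1%:R : K) != 0) ->
  quasi_projective_variety X -> has_dim X n -> (1 <= n)%N ->
  tangent_variety X = secant_variety X ->
  generically (nonsingular X) (third_fundamental_form_eq0 X).
Proof.
move=> char0 qpX dimX n_gt0 tau_sec.
have coneX := quasi_projective_cone qpX.
have primeX := zirreducible_prime char0 coneX qpX.2.
have [f indf] := chain_independent char0 coneX dimX.1.
have [V [h [h_nz tangent_V V_f]]] := independent_vfields char0 primeX indf.
have [d [b [e [d_nz osc]]]] :=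
  third_derivative_osculating char0 coneX primeX dimX h_nz tangent_V V_f n_gt0 tau_sec.
have [s0 d0] : exists s, ~ vanish X (bundle_slice s d).
  apply: contrapT => H; apply: d_nz => u s Xu; rewrite -bundle_sliceE.
  by apply: contrapT => du; apply: H; exists s => /(_ u Xu).
have nsX := exists_nonsingular coneX primeX dimX n_gt0 tau_sec.
have [x nsx hdx] := generic_nonsingular primeX dimX h_nz tangent_V V_f nsX d0.
exists (zlocus (h * bundle_slice s0 d)); split.
- exact: zlocus_closed.
- exists x; split=> // /zlocus_meval; rewrite mevalM => e0.
  by rewrite e0 eqxx in hdx.
move=> y [nsy /not_zlocus]; have Xy : X y by case: nsy.
move=> /(_ char0 (coneX.1 _ Xy))[t t0]; rewrite mevalM mulf_eq0 negb_or bundle_sliceE.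
move=> /andP[hy dy].
apply: no_cubic_term_third_fundamental_form => //.
apply: (no_cubic_term_scale coneX t0).
apply: (good_no_cubic_term char0 tangent_V osc _ dy); first exact: coneX.2.
move=> v; apply: (nonsingular_span dimX tangent_V V_f _ hy).
exact: nonsingular_scale.
Qed.

Theorem corollary1p2 (R : realType) (r n : nat)
    (X : set 'rV[R[i]]_r.+1) :
  quasi_projective_variety X -> has_dim X n -> (1 <= n)%N ->
  tangent_variety X = secant_variety X ->
  generically (nonsingular X) (third_fundamental_form_eq0 X).
Proof.
apply: generic_third_fundamental_form => m.
by rewrite Num.Theory.pnatr_eq0.
Qed.
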